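(* Let $a\in\mathbb{R}$ and suppose that $\{\lambda_i,\varphi_i(a)\}_{i=1}^N$ is the interior spectral data at $a$ of some pair $(\omega,v)$. Assume that $\alpha=0$, $\beta\neq0$, and $\varphi_i(a)\neq0$ for all $i=1,\dots,N$. (i) If $\lambda_1>0$ or $\lambda_N<0$, then $\{\lambda_i,\varphi_i(a)\}_{i=1}^N$ uniquely determines $\omega,v$ (exactly one pair has this interior spectral data at $a$). (ii) If $\lambda_{j_0}<0<\lambda_{j_0+1}$ for some $j_0\in\{1,\dots,N-1\}$, then exactly two pairs $(\omega,v)$ yield the given interior spectral data $\{\lambda_i,\varphi_i(a)\}_{i=1}^N$ at $a$.
   Context: A pair $(\omega,v)$ means: for some $n\in\mathbb{N}$, $n\ge 1$, and real points $x_1<\dots<x_n$, $\omega=\sum_{i=1}^n\omega_i\delta_{x_i}$ and $v=\sum_{i=1}^n v_i\delta_{x_i}$ with $\omega_i\in\mathbb{R}$, $v_i\ge 0$ and $|\omega_i|+v_i>0$ ($\delta_x$ is the Dirac measure at $x$). The number $n$, the points and the weights may differ from pair to pair. For $z\in\mathbb{C}$ consider $-f''+\frac14 f=z\omega f+z^2vf$ on $\mathbb{R}$, meaning: $f$ is continuous, $-f''+\frac14 f=0$ on $\mathbb{R}\setminus\{x_1,\dots,x_n\}$, and $f'(x_i-)=f'(x_i+)+z\omega_if(x_i)+z^2v_if(x_i)$ for every $i$. An eigenvalue is a $z$ for which there is a nontrivial bounded solution. The eigenvalues form a finite set of nonzero real numbers $\lambda_1<\dots<\lambda_N$. For $z\in\mathbb{C}$,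 $\phi_\pm(z,\cdot)$ are the solutions with $\phi_\pm(z,x)=e^{\mp x/2}$ for all $x$ near $\pm\infty$. For an eigenvalue $\lambda$ put $\gamma_\lambda^2:=\int_{\mathbb{R}}|\phi_+(\lambda,x)|^2d\omega(x)+2\lambda\int_{\mathbb{R}}|\phi_+(\lambda,x)|^2dv(x)$; one has $\lambda\gamma_\lambda^2>0$. The normalized eigenfunctions are $\varphi_i(x)=\phi_+(\lambda_i,x)/\sqrt{\lambda_i\gamma_{\lambda_i}^2}$. For $a\in\mathbb{R}$, the family $\{\lambda_i,\varphi_i(a)\}_{i=1}^N$ is called the interior spectral data of $(\omega,v)$ at $a$. Put $\alpha:=1-\sum_{i=1}^N|\varphi_i(a)|^2$ and $\beta:=-\sum_{i=1}^N\lambda_i|\varphi_i(a)|^2$. *)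

(* Defs.v *)
From mathcomp Require Import all_boot all_order all_algebra.
From mathcomp Require Import all_classical all_reals all_analysis.
From mathcomp Require Import complex.

Set Implicit Arguments.
Unset Strict Implicit.
Unset Printing Implicit Defensive.
Import Order.TTheory GRing.Theory Num.Theory.
Import numFieldNormedType.Exports.

Local Open Scope classical_set_scope.
Local Open Scope complex_scope.
Local Open Scope ring_scope.

Notation normc := ComplexField.Normc.normc.

(* The library puts no real normed-module structure on R[i], so limits,
   continuity and derivatives of functions from R to R[i] are taken
   componentwise. *)
Section ComplexValued.
Variable R : realType.
Implicit Types f : R -> R[i].

Definition re f (x : R) : R := complex.Re (f x).
Definition im f (x : R) : R := complex.Im (f x).

Definition cvgC (F : set_system R) f (l : R[i]) : Prop :=
  (re f @ F --> complex.Re l) /\ (im f @ F --> complex.Im l).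

Definition continuousC f : Prop := continuous (re f) /\ continuous (im f).

Definition derivableC f (x : R) : Prop :=
  derivable (re f) x 1 /\ derivable (im f) x 1.

Definition deriveC f (x : R) : R[i] := derive1 (re f) x +i* derive1 (im f) x.

End ComplexValued.

Section Pairs.
Variable R : realType.

(* A triple (x_i, omega_i, v_i). *)
Definition pos (t : R * R * R) : R := t.1.1.
Definition womega (t : R * R * R) : R := t.1.2.
Definition wv (t : R * R * R) : R := t.2.

(* The pair omega = \sum_i omega_i delta_(x_i), v = \sum_i v_i delta_(x_i).
   Since the points increase strictly and no atom carries zero mass for both
   measures, the two measures determine the list of atoms, so Leibniz equality
   of [mpair]s is equality of the pairs of measures. *)
Record mpair := MPair {
  atoms : seq (R * R * R);
  mpairP : [&& (0 < size atoms)%N,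
               sorted <%R (map pos atoms),
               all (fun t => 0 <= wv t) atoms &
               all (fun t => 0 < `|womega t| + wv t) atoms]
}.

Definition int_omega (p : mpair) (g : R -> R) : R :=
  \sum_(t <- atoms p) womega t * g (pos t).

Definition int_v (p : mpair) (g : R -> R) : R :=
  \sum_(t <- atoms p) wv t * g (pos t).

Definition is_solution (p : mpair) (z : R[i]) (f : R -> R[i]) : Prop :=
  [/\ continuousC f,
      forall x : R, x \notin map pos (atoms p) ->
        [/\ derivableC f x, derivableC (deriveC f) x &
            - deriveC (deriveC f) x + (4%:R^-1)%:C * f x = 0] &
      forall t, t \in atoms p -> exists l r : R[i],
        [/\ cvgC ((pos t)^'-) (deriveC f) l, cvgC ((pos t)^'+) (deriveC f) r &
            l = r + z * (womega t)%:C * f (pos t)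
                  + z ^+ 2 * (wv t)%:C * f (pos t)]].

Definition is_eigenvalue (p : mpair) (z : R[i]) : Prop :=
  exists f : R -> R[i],
    [/\ is_solution p z f, exists x, f x != 0 &
        exists M : R, forall x, normc (f x) <= M].

Definition is_phi_plus (p : mpair) (z : R[i]) (phi : R -> R[i]) : Prop :=
  is_solution p z phi /\
  \forall x \near +oo, phi x = (expR (- x / 2%:R))%:C.

Definition gamma_sq (p : mpair) (lambda : R) (phi : R -> R[i]) : R :=
  int_omega p (fun x => normc (phi x) ^+ 2)
  + 2%:R * lambda * int_v p (fun x => normc (phi x) ^+ 2).

(* [lambda] lists the eigenvalues in increasing order and [c i] is the value
   at [a] of the i-th normalized eigenfunction; [phi] is the unique solution
   phi_+(lambda_i, .). *)
Definition is_interior_data (p : mpair) (a : R) (N : nat)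
    (lambda : 'I_N -> R) (c : 'I_N -> R[i]) : Prop :=
  [/\ forall i j : 'I_N, (i < j)%N -> lambda i < lambda j,
      forall z : R[i], is_eigenvalue p z <-> exists i, z = (lambda i)%:C &
      forall i, exists phi : R -> R[i],
        is_phi_plus p (lambda i)%:C phi /\
        c i = phi a / (Num.sqrt (lambda i * gamma_sq p (lambda i) phi))%:C].

Definition alpha (N : nat) (c : 'I_N -> R[i]) : R :=
  1 - \sum_(i < N) normc (c i) ^+ 2.

Definition beta (N : nat) (lambda : 'I_N -> R) (c : 'I_N -> R[i]) : R :=
  - \sum_(i < N) lambda i * normc (c i) ^+ 2.

End Pairs.

(* Main.v *)
Require Import Defs.
From mathcomp Require Import all_boot all_order all_algebra.
From mathcomp Require Import all_classical all_reals all_analysis.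
From mathcomp Require Import complex polyrcf ring lra.

(** Between two consecutive atoms every solution has the form
[A e^(x/2) + B e^(-x/2)], and crossing an atom multiplies [(A, B)] by a
unimodular matrix whose entries are polynomials in z. Hence phi_+(z, a),
phi_-(z, a) and their Wronskian W(z) are polynomials in z, and the eigenvalues
are the roots of W ([eigenvalue_root]). Differentiating the product of
matrices in z gives gamma^2 = - A W' at an eigenvalue, where
phi_+ = A phi_- ([gamma_polyE], [phi_at_eigenvalue_poly]), so that
phi_+(a) phi_-(a) = - lambda W'(lambda) c^2 at each eigenvalue lambda
([interior_data_values]). The degree of phi_+ phi_- is at most that of W, so
these values, together with the value 1 at z = 0, determine the product
K(z) = phi_+(z, a) phi_-(z, a); when alpha = 0 this reads
K/W = sum_i lambda_i c_i^2 / (lambda_i - z). In the variable w = 1/z the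
right-hand side is w times sum_i c_i^2 / (w - 1/lambda_i). Its zeros kappa_j
therefore interlace the numbers 1/lambda_i ([interlace_recip]), and beta <> 0
says that no kappa_j vanishes.

Once K is known, what is left to find is the set S of those kappa_j that
belong to phi_+(., a). The sign of c_i is the sign of phi_+(lambda_i, a). In a
gap between two reciprocals of equal sign it decides whether kappa_j lies in S
([signs_determine]); in a gap that contains 0 it gives no information, because
1 - kappa_j z is then positive at all the eigenvalues ([straddling_gap]). Such
a gap exists exactly when there are eigenvalues of both signs, and it is
unique. This leaves one candidate for S in case (i) and two in case (ii).

Each candidate comes from exactly one pair. Uniqueness: W, phi_+(., a) and
phi_-(., a) determine the logarithmic derivatives on both sides of a and the
atom at a ([mpair_determined]), and the behaviour at z = oo of the logarithmic
derivative reveals the atoms of a half-line one after the other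
([phi_grow_inj]). Existence: the partial fraction expansion of W/K has residues
of one sign; its terms are shared out between the two half-lines according to
S, its linear term becomes an atom at a ([pair_of_splitting]), and on a
half-line a string with prescribed residues is produced by a continued
fraction expansion, each step of which is again the interlacing lemma
([string_of_residues]). *)

Set Implicit Arguments.
Unset Strict Implicit.
Unset Printing Implicit Defensive.
Import Order.TTheory GRing.Theory Num.Theory.
Import numFieldNormedType.Exports.
Local Open Scope complex_scope.
Local Open Scope ring_scope.

(** * Interlacing of zeros and poles *)

Section Interlace.
Variable R : rcfType.

Definition cofac n (nu : 'I_n -> R) (i : 'I_n) : {poly R} :=
  \prod_(k < n | k != i) ('X - (nu k)%:P).

Lemma cofac_monic n (nu : 'I_n -> R) i : cofac nu i \is monic.
Proof. by apply: monic_prod => k _; exact: monicXsubC. Qed.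

Lemma size_cofac n (nu : 'I_n.+1 -> R) i : size (cofac nu i) = n.+1.
Proof.
rewrite size_prod => [|k _]; last by rewrite polyXsubC_eq0.
rewrite (eq_bigr (fun=> 2)) => [|k _]; last by rewrite size_XsubC.
rewrite sum_nat_const cardC1 card_ord /= muln2 -addnn -addSn addnK //.
Qed.

Lemma cofacM n (nu : 'I_n -> R) i :
  ('X - (nu i)%:P) * cofac nu i = \prod_(k < n) ('X - (nu k)%:P).
Proof. by rewrite (bigD1 i). Qed.

Lemma horner_cofac_eq n (nu : 'I_n -> R) i :
  (cofac nu i).[nu i] = \prod_(k < n | k != i) (nu i - nu k).
Proof. by rewrite horner_prod; apply: eq_bigr => k _; rewrite !hornerE. Qed.

Lemma horner_cofac_neq n (nu : 'I_n -> R) i j : i != j ->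
  (cofac nu j).[nu i] = 0.
Proof.
by move=> ij; rewrite horner_prod (bigD1 i) //= !hornerE subrr mul0r.
Qed.

Lemma lagrange_cofac n (kap : 'I_n -> R) (p : {poly R}) :
  injective kap -> (size p <= n)%N ->
  p = \sum_(j < n) (p.[kap j] / (cofac kap j).[kap j]) *: cofac kap j.
Proof.
case: n kap => [|n] kap inj sp.
  by move: sp; rewrite big_ord0 leqn0 size_poly_eq0 => /eqP.
apply/eqP; rewrite -subr_eq0; apply/eqP.
apply: (@roots_geq_poly_eq0 _ _ [seq kap j | j <- enum 'I_n.+1]).
- apply/allP => _ /mapP [j _ ->]; rewrite rootE !hornerE horner_sum.
  rewrite (bigD1 j) //= big1 => [|k kj]; last first.
    by rewrite !hornerE (@horner_cofac_neq _ _ j k) ?mulr0 1?eq_sym.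
  rewrite !hornerE divfK ?subrr // horner_cofac_eq.
  by apply/prodf_neq0 => k kj; rewrite subr_eq0 (inj_eq inj) eq_sym.
- by rewrite map_inj_uniq // enum_uniq.
rewrite size_map size_enum_ord (leq_trans (size_polyD _ _)) // geq_max sp.
rewrite size_polyN; apply: (leq_trans (size_sum _ _ _)).
apply/bigmax_leqP => j _.
by apply: (leq_trans (size_scale_leq _ _)); rewrite size_cofac.
Qed.

Lemma size_prodX n (nu : 'I_n -> R) : size (\prod_i ('X - (nu i)%:P)) = n.+1.
Proof. by rewrite -big_enum size_prod_XsubC size_enum_ord. Qed.

(** For sum_i c_i / (w - nu_i) with positive c_i, the numerator alternates in sign
along the nu_i, since at nu_i only one summand survives; the intermediate value
theorem then gives as many zeros as the degree allows. *)
Lemma interlace n (nu c : 'I_n.+1 -> R) :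
  (forall i j : 'I_n.+1, (i < j)%N -> nu i < nu j) -> (forall i, 0 < c i) ->
  exists2 kap : 'I_n -> R,
    (forall j : 'I_n, nu (widen_ord (leqnSn n) j) < kap j < nu (lift ord0 j)) &
    \sum_i c i *: cofac nu i = (\sum_i c i) *: \prod_j ('X - (kap j)%:P).
Proof.
move=> numon c0; set f := \sum_i c i *: cofac nu i.
have fnu i : f.[nu i] = c i * (cofac nu i).[nu i].
  rewrite horner_sum (bigD1 i) //= big1 ?addr0 ?hornerE // => k ki.
  by rewrite hornerE (@horner_cofac_neq _ _ i k) ?mulr0 1?eq_sym.
have numon' (i j : 'I_n.+1) : (nu i < nu j) = (i < j)%N.
  by case: ltngtP => [/numon //|/numon /ltW /le_gtF|/val_inj ->]; rewrite ?ltxx.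
have gap (j : 'I_n) : exists2 x, nu (widen_ord (leqnSn n) j) < x < nu (lift ord0 j)
    & root f x.
  set u := widen_ord _ j; set v := lift ord0 j.
  have uv : (u < v)%N by [].
  have [//||x /itvP xuv fx] := @poly_ivtoo _ f (nu u) (nu v).
  - by rewrite ltW ?numon'.
  - rewrite !fnu mulrACA pmulr_rlt0 ?mulr_gt0 // !horner_cofac_eq.
    rewrite (bigD1 v) /= 1?eq_sym ?neq_ltn ?uv //.
    rewrite [X in _ * X](bigD1 u) /= ?neq_ltn ?uv //.
    rewrite mulrACA [X in _ * (_ * X)](eq_bigl (fun k => (k != u) && (k != v))).
      rewrite -big_split /= nmulr_rlt0.
        apply: prodr_gt0 => k /andP[ku kv].
        have [kltu|ulek] := ltnP k u.
          by rewrite mulr_gt0 // subr_gt0 numon' // (ltn_trans kltu).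
        have ultk : (u < k)%N by rewrite ltn_neqAle eq_sym ku.
        have vltk : (v < k)%N by rewrite ltn_neqAle eq_sym kv.
        by rewrite nmulr_lgt0 subr_lt0 numon'.
      by rewrite nmulr_rlt0 ?subr_gt0 ?subr_lt0 numon'.
    by move=> k; rewrite andbC.
  by exists x => //; rewrite !xuv.
have [kap kapin kaproot] := fin_all_exists2 gap.
exists kap => //.
have kapmon (i j : 'I_n) : (i < j)%N -> kap i < kap j.
  move=> ij; have /andP[_ h1] := kapin i; have /andP[h2 _] := kapin j.
  apply: (lt_le_trans h1); apply: le_trans (ltW h2).
  by rewrite leNgt numon' -leqNgt.
have kapinj : injective kap.
  move=> i j e; apply/val_inj.
  by case: (ltngtP i j) => // /kapmon; rewrite e ltxx.
have sf : (size f <= n.+1)%N.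
  apply: (leq_trans (size_sum _ _ _)); apply/bigmax_leqP => j _.
  by apply: (leq_trans (size_scale_leq _ _)); rewrite size_cofac.
have fn : f`_n = \sum_i c i.
  rewrite coef_sum; apply: eq_bigr => i _; rewrite coefZ.
  have := cofac_monic nu i; rewrite monicE /lead_coef size_cofac /= => /eqP ->.
  by rewrite mulr1.
have C0 : 0 < \sum_i c i.
  rewrite (bigD1 ord0) //= ltr_pwDl // sumr_ge0 // => i _; exact: ltW.
have sfE : size f = n.+1.
  apply/eqP; rewrite eqn_leq sf ltnNge; apply/negP => /leq_sizeP /(_ n (leqnn n)).
  by rewrite fn => /eqP; rewrite gt_eqF.
rewrite (@all_roots_prod_XsubC _ f [seq kap j | j <- enum 'I_n]).
- by rewrite lead_coefE sfE /= fn big_map big_enum.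
- by rewrite size_map size_enum_ord.
- by apply/allP => _ /mapP[j _ ->].
- by rewrite uniq_rootsE map_inj_uniq // enum_uniq.
Qed.

(** The reciprocal of sum_i c_i / (w - nu_i) is a linear polynomial minus simple
fractions with positive coefficients: at a zero kappa the residue of the reciprocal
is the inverse of the derivative, and the derivative - sum_i c_i / (w - nu_i)^2
is negative. *)
Lemma interlace_residues n (nu c : 'I_n.+1 -> R) (kap : 'I_n -> R) (C : R) :
  (forall i, 0 < c i) -> injective kap -> C != 0 -> injective nu ->
  \sum_i c i *: cofac nu i = C *: \prod_j ('X - (kap j)%:P) ->
  exists b, exists2 rho : 'I_n -> R, (forall j, 0 < C * rho j) &
    \prod_i ('X - (nu i)%:P) = ('X - b%:P) * \prod_j ('X - (kap j)%:P)
       - \sum_j rho j *: cofac kap j.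
Proof.
move=> c0 kapinj C0 nuinj E; set K := \prod_j _ in E *; set W := \prod_i _.
have mW : W \is monic by apply: monic_prod => k _; exact: monicXsubC.
have mK : K \is monic by apply: monic_prod => k _; exact: monicXsubC.
have sW : size W = n.+2 by rewrite size_prodX.
have sK : size K = n.+1 by rewrite size_prodX.
(* this [b] cancels the coefficient of w^n; the truncated [n.-1] is harmless
   because of the boolean factor *)
pose b := K`_n.-1 *+ (0 < n)%N - W`_n.
pose S := ('X - b%:P) * K - W.
have sS : (size S <= n)%N.
  have Kn : K`_n = 1 by move: mK; rewrite monicE lead_coefE sK => /eqP.
  have Wn : W`_n.+1 = 1 by move: mW; rewrite monicE lead_coefE sW => /eqP.
  apply/leq_sizeP => k; rewrite /S mulrBl !coefB coefXM coefCM leq_eqVlt.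
  case/predU1P=> [<-|nk].
    by rewrite Kn /b; case: (n) => [|m] /=; rewrite ?mulr0n ?mulr1n; ring.
  rewrite (@nth_default _ 0 K k) ?sK // mulr0 subr0 gtn_eqF ?(leq_ltn_trans _ nk) //.
  move: nk; rewrite leq_eqVlt => /predU1P[<-|nk].
    by rewrite /= Kn Wn subrr.
  by rewrite !nth_default ?subr0 ?sW ?sK // -ltnS (ltn_predK nk).
have ES := lagrange_cofac kapinj sS.
exists b, (fun j => S.[kap j] / (cofac kap j).[kap j]); last first.
  by rewrite -ES /S opprB addrC subrK.
move=> j /=.
have Kj : K.[kap j] = 0 by rewrite /K -(cofacM kap j) !hornerE subrr mul0r.
have -> : S.[kap j] = - W.[kap j] by rewrite /S !hornerE Kj mulr0 sub0r.
(* the derivative of sum_i c_i / (w - nu_i), multiplied by W^2 *)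
have wr : (\sum_i c i *: cofac nu i)^`() * W - (\sum_i c i *: cofac nu i) * W^`()
   = - \sum_i c i *: (cofac nu i) ^+ 2.
  rewrite linear_sum !mulr_suml -sumrB -sumrN; apply: eq_bigr => i _ /=.
  rewrite linearZ /= -!scalerAl -scalerBr -scalerN; congr (_ *: _).
  by rewrite /W -(cofacM nu i) derivM derivXsubC mul1r; ring.
have Kd : K^`().[kap j] = (cofac kap j).[kap j].
  by rewrite /K -(cofacM kap j) derivM derivXsubC !hornerE subrr mul0r addr0.
have cn0 : (cofac kap j).[kap j] != 0.
  rewrite horner_cofac_eq; apply/prodf_neq0 => k kj.
  by rewrite subr_eq0 (inj_eq kapinj) eq_sym.
move: wr => /(congr1 (horner^~ (kap j))); rewrite E derivZ !hornerE Kj Kd !(mulr0,mul0r,subr0).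
rewrite horner_sum => wr.
have : C * (cofac kap j).[kap j] * W.[kap j] < 0.
  rewrite wr oppr_lt0.
  have sq i : 0 <= (c i *: cofac nu i ^+ 2).[kap j].
    by rewrite hornerZ horner_exp mulr_ge0 ?sqr_ge0 // ltW.
  rewrite lt_neqAle sumr_ge0 // andbT eq_sym; apply/negP => /eqP /psumr_eq0P z.
  have {}z i : (cofac nu i).[kap j] = 0.
    have := z (fun i _ => sq i) i isT; rewrite hornerZ horner_exp => /eqP.
    by rewrite mulf_eq0 gt_eqF // orFb expf_eq0 => /eqP.
  have : W.[kap j] == 0 by rewrite /W -(cofacM nu ord0) hornerM z mulr0.
  rewrite /W horner_prod prodf_seq_eq0 => /hasP[i _ /=].
  rewrite !hornerE subr_eq0 => /eqP ki.
  have /eqP := z i; rewrite ki horner_cofac_eq; apply/negP/prodf_neq0 => k ne.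
  by rewrite subr_eq0 (inj_eq nuinj) eq_sym.
move=> neg; suff: 0 < C * - W.[kap j] / (cofac kap j).[kap j] by [].
have -> : C * - W.[kap j] / (cofac kap j).[kap j] =
  - (C * (cofac kap j).[kap j] * W.[kap j]) / (cofac kap j).[kap j] ^+ 2.
  by field.
by rewrite divr_gt0 ?oppr_gt0 // exprn_even_gt0.
Qed.
End Interlace.

(** * Polynomials given by the reciprocals of their roots *)

Section ZForm.
Variable R : rcfType.

(** Lets identities in w = 1/z be transported to polynomials in z. *)
Lemma poly_eq_off0 (p q : {poly R}) : (forall z, z != 0 -> p.[z] = q.[z]) -> p = q.
Proof.
move=> H; apply/eqP; rewrite -subr_eq0; apply/eqP.
apply: (@roots_geq_poly_eq0 _ _ [seq i.+1%:R | i <- iota 0 (size (p - q))]).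
- by apply/allP => _ /mapP[i _ ->]; rewrite rootE !hornerE H ?subrr // pnatr_eq0.
- rewrite map_inj_uniq ?iota_uniq // => i j /eqP.
  by rewrite eqr_nat eqSS => /eqP.
by rewrite size_map size_iota.
Qed.

Lemma exists_increasing n (nu : 'I_n.+1 -> R) : injective nu ->
  exists2 tau : 'I_n.+1 -> 'I_n.+1, injective tau &
    forall i j : 'I_n.+1, (i < j)%N -> nu (tau i) < nu (tau j).
Proof.
move=> inj; pose r i j := nu i <= nu j.
have rtr : transitive r by move=> x y z; exact: le_trans.
pose s := sort r (enum 'I_n.+1).
have ss : sorted r s by apply: sort_sorted => i j; exact: le_total.
have us : uniq s by rewrite sort_uniq enum_uniq.
have sz : size s = n.+1 by rewrite size_sort size_enum_ord.
have tinj : injective (fun i : 'I_n.+1 => nth ord0 s i).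
  by move=> i j /eqP; rewrite nth_uniq ?sz // => /eqP /val_inj.
exists (fun i : 'I_n.+1 => nth ord0 s i) => // i j ij.
rewrite lt_neqAle (inj_eq inj) (inj_eq tinj) neq_ltn ij /=.
by apply: (sorted_ltn_nth rtr ord0 ss) => //; rewrite inE sz.
Qed.

(** A polynomial normalized by its value 1 at 0, given by the reciprocals of its
roots; [kap j = 0] is a root at infinity and contributes the factor 1. *)
Definition recip_prod n (kap : 'I_n -> R) (S : {set 'I_n}) : {poly R} :=
  \prod_(j in S) (1 - kap j *: 'X).

(** The numerator of sum_j r_j kap_j z / (1 - kap_j z) over the denominator
[recip_prod kap S]. *)
Definition residue_poly n (kap r : 'I_n -> R) (S : {set 'I_n}) : {poly R} :=
  'X * \sum_(j in S) (r j * kap j) *: recip_prod kap (S :\ j).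

Lemma horner_recip_prod n (kap : 'I_n -> R) (S : {set 'I_n}) z :
  (recip_prod kap S).[z] = \prod_(j in S) (1 - kap j * z).
Proof. by rewrite horner_prod; apply: eq_bigr => j _; rewrite !hornerE. Qed.

Lemma recip_prodD1 n (kap : 'I_n -> R) (S : {set 'I_n}) j : j \in S ->
  recip_prod kap S = (1 - kap j *: 'X) * recip_prod kap (S :\ j).
Proof. by move=> jS; rewrite /recip_prod (big_setD1 j). Qed.

Lemma recip_prod_reverse n (nu : 'I_n -> R) z : z != 0 ->
  (recip_prod nu finset.setT).[z] = z ^+ n * (\prod_i ('X - (nu i)%:P)).[z^-1].
Proof.
move=> z0; rewrite horner_recip_prod horner_prod (eq_bigl xpredT) => [|i]; last by rewrite inE.
rewrite -[in z ^+ n](card_ord n) -prodr_const -big_split /=.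
by apply: eq_bigr => i _; rewrite !hornerE mulrBr divff // mulrC.
Qed.

Lemma recip_prod_cofac n (nu : 'I_n.+1 -> R) i z : z != 0 ->
  (recip_prod nu [set~ i]).[z] = z ^+ n * (cofac nu i).[z^-1].
Proof.
move=> z0; rewrite horner_recip_prod horner_prod.
have -> : z ^+ n = z ^+ #|[set~ i]| by rewrite cardsC1 card_ord.
rewrite -prodr_const (eq_bigl (fun k => k != i)); last by move=> k; rewrite !inE.
rewrite [X in X * _](eq_bigl (fun k => k != i)); last by move=> k; rewrite !inE.
rewrite -big_split /=.
by apply: eq_bigr => k _; rewrite !hornerE mulrBr divff // mulrC.
Qed.

Lemma recip_prod_cofacM n (nu : 'I_n -> R) i z : z != 0 ->
  z * (recip_prod nu [set~ i]).[z] = z ^+ n * (cofac nu i).[z^-1].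
Proof. by case: n nu i => [|n] nu i z0; [case: i | rewrite recip_prod_cofac // exprS mulrA]. Qed.

Lemma sum_cofac_reindex n (nu c : 'I_n -> R) (tau : 'I_n -> 'I_n) : injective tau ->
  \sum_i c i *: cofac nu i = \sum_i c (tau i) *: cofac (nu \o tau) i.
Proof.
move=> inj; rewrite (reindex_inj inj) /=; apply: eq_bigr => i _; congr (_ *: _).
rewrite /cofac (reindex_inj inj) /=; apply: eq_bigl => j; by rewrite (inj_eq inj).
Qed.

(** The interlacing of [interlace] and the expansion of [interlace_residues], read
in the variable z = 1/w. The permutation [tau] sorts [nu]. *)
Lemma interlace_recip n (nu c : 'I_n.+1 -> R) :
  injective nu -> (forall i, 0 < c i) ->
  exists tau : 'I_n.+1 -> 'I_n.+1, exists kap rho : 'I_n -> R, exists b : R,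
  [/\ injective tau,
      (forall i j : 'I_n.+1, (i < j)%N -> nu (tau i) < nu (tau j)),
      (forall j : 'I_n, nu (tau (widen_ord (leqnSn n) j)) < kap j < nu (tau (lift ord0 j))),
      \sum_i c i *: recip_prod nu [set~ i] = (\sum_i c i) *: recip_prod kap finset.setT &
      [/\ injective kap, (forall j, 0 < rho j) &
      recip_prod nu finset.setT = (1 - b *: 'X) * recip_prod kap finset.setT
        - 'X ^+ 2 * \sum_j rho j *: recip_prod kap [set~ j]]].
Proof.
move=> inj c0; have [tau tinj tmon] := exists_increasing inj.
have [kap kapin E] := @interlace R n (nu \o tau) (c \o tau) tmon (fun i => c0 _).
have kapmon (i j : 'I_n) : (i < j)%N -> kap i < kap j.
  move=> ij; have /andP[_ h1] := kapin i; have /andP[h2 _] := kapin j.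
  apply: (lt_le_trans h1); apply: le_trans (ltW h2).
  have : (lift ord0 i <= widen_ord (leqnSn n) j)%N by [].
  rewrite leq_eqVlt => /orP[/eqP e|/tmon/ltW//].
  by rewrite /= (_ : lift ord0 i = widen_ord (leqnSn n) j) //; exact/val_inj.
have kapinj : injective kap.
  move=> i j e; apply/val_inj.
  by case: (ltngtP i j) => // /kapmon; rewrite e ltxx.
have C0 : 0 < \sum_i c i.
  by rewrite (bigD1 ord0) //= ltr_pwDl // sumr_ge0 // => i _; exact: ltW.
have CE : \sum_i (c \o tau) i = \sum_i c i by rewrite [RHS](reindex_inj tinj).
rewrite CE -(sum_cofac_reindex nu c tinj) in E.
have [b [rho rho0 F]] := interlace_residues c0 kapinj (lt0r_neq0 C0) inj E.
exists tau, kap, rho, b; split=> //.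
  apply: poly_eq_off0 => z z0; rewrite hornerZ recip_prod_reverse // mulrCA -hornerZ -E.
  rewrite !horner_sum mulr_sumr; apply: eq_bigr => i _.
  by rewrite !hornerZ recip_prod_cofac // mulrCA.
split=> // [j|]; first by rewrite -(pmulr_rgt0 _ C0).
apply: poly_eq_off0 => z z0; rewrite recip_prod_reverse // F.
have E1 : (1 - b *: 'X).[z] = 1 - b * z by rewrite !hornerE.
rewrite [LHS]mulrC hornerD hornerN hornerM hornerXsubC mulrBl [RHS]hornerD hornerN.
rewrite !hornerM E1 hornerX recip_prod_reverse // !horner_sum; congr (_ - _).
  by rewrite exprS; field.
rewrite mulrC.
rewrite !mulr_sumr; apply: eq_bigr => j _; rewrite !hornerZ.
transitivity (z * rho j * (z * (recip_prod kap [set~ j]).[z])); last by ring.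
by rewrite recip_prod_cofacM // exprS; ring.
Qed.
Lemma recip_prod_support n (kap : 'I_n -> R) (S T : {set 'I_n}) :
  S \subset T -> (forall j, j \in T -> j \notin S -> kap j = 0) ->
  recip_prod kap T = recip_prod kap S.
Proof.
move=> ST z; rewrite /recip_prod [LHS]big_mkcond [RHS]big_mkcond; apply: eq_bigr => j _.
case: ifP => jT; case: ifP => jS //; first by rewrite z ?jS // scale0r subr0.
by rewrite (fintype.subsetP ST _ jS) in jT.
Qed.

Lemma recip_prod_setD_enum n (kap : 'I_n -> R) (S : {set 'I_n}) (i : 'I_#|S|) :
  recip_prod (fun l : 'I_#|S| => kap (enum_val l)) (finset.setT :\ i) =
    recip_prod kap (S :\ enum_val i).
Proof.
rewrite /recip_prod (eq_bigl (fun l => l != i)) => [|l]; last by rewrite !inE andbT.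
rewrite [RHS](eq_bigl (fun j => (j \in S) && (j != enum_val i))) => [|j]; last first.
  by rewrite !inE andbC.
rewrite big_enum_val_cond /=; apply: eq_bigl => l.
by rewrite (inj_eq enum_val_inj).
Qed.

Lemma recip_prod_enum n (kap : 'I_n -> R) (S : {set 'I_n}) :
  recip_prod (fun l : 'I_#|S| => kap (enum_val l)) finset.setT = recip_prod kap S.
Proof.
by rewrite /recip_prod [RHS]big_enum_val /=; apply: eq_bigl => l; rewrite inE.
Qed.

Lemma residue_poly_enum n (kap r : 'I_n -> R) (S : {set 'I_n}) :
  residue_poly (fun l : 'I_#|S| => kap (enum_val l)) (fun l =>
    r (enum_val l)) finset.setT = residue_poly kap r S.
Proof.
rewrite /residue_poly [in RHS]big_enum_val /=; congr (_ * _).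
rewrite (eq_bigl xpredT) => [|l]; last by rewrite inE.
by apply: eq_bigr => l _; rewrite recip_prod_setD_enum.
Qed.

Lemma size_linear_factor (k : R) : (size (1 - k *: 'X : {poly R})%R <= 2)%N.
Proof.
rewrite (leq_trans (size_polyD _ _)) // geq_max size_poly1 size_polyN.
by rewrite (leq_trans (size_scale_leq _ _)) ?size_polyX.
Qed.

Lemma size_linear_factor_eq (k : R) : k != 0 -> size (1 - k *: 'X : {poly R})%R = 2.
Proof.
by move=> k0; rewrite addrC size_polyDl size_polyN size_scale // size_polyX ?size_poly1.
Qed.

Lemma size_recip_prod_leq n (kap : 'I_n ->
  R) (S : {set 'I_n}) : (size (recip_prod kap S) <= #|S|.+1)%N.
Proof.
rewrite (leq_trans (size_prod_leq _ _)) // leq_subLR.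
rewrite addnS ltnS -sum1_card -big_split /=; apply: leq_sum => j _; exact: size_linear_factor.
Qed.

Lemma size_recip_prod n (kap : 'I_n -> R) (S : {set 'I_n}) :
  (forall j, j \in S -> kap j != 0) -> size (recip_prod kap S) = #|S|.+1.
Proof.
move=> k0; rewrite size_prod => [|j jS]; last first.
  by rewrite -size_poly_eq0 size_linear_factor_eq // k0.
rewrite (eq_bigr (fun=> 2)) => [|j jS]; last by rewrite size_linear_factor_eq // k0.
by rewrite sum_nat_const muln2 -addnn -addSn addnK.
Qed.

Lemma size_residue_poly_leq n (kap r : 'I_n -> R) (S : {set 'I_n}) :
  (size (residue_poly kap r S) <= #|S|.+1)%N.
Proof.
rewrite /residue_poly (leq_trans (size_polyMleq _ _)) // size_polyX /=.
rewrite ltnS (leq_trans (size_sum _ _ _)) //; apply/bigmax_leqP => j jS.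
rewrite (leq_trans (size_scale_leq _ _)) // (leq_trans (size_recip_prod_leq _ _)) //.
by rewrite [X in (_ <= X)%N](cardsD1 j) jS.
Qed.

Lemma recip_prod_neq0 n (kap : 'I_n -> R) (S : {set 'I_n}) : recip_prod kap S != 0.
Proof.
apply/eqP => /(congr1 (horner^~ 0)); rewrite horner_recip_prod horner0 big1 => [|j _].
  by move/eqP; rewrite oner_eq0.
by rewrite mulr0 subr0.
Qed.
End ZForm.

(** * Transfer across atoms *)

Section Transfer.
Variables (R : realType) (K : comNzRingType) (e : {rmorphism R -> K}) (z : K).
Implicit Types (t : R * R * R) (s : seq (R * R * R)) (u v : K * K).

Definition jump t : K := z * e (womega t) + z ^+ 2 * e (wv t).

(** For a solution equal to A e^(x/2) + B e^(-x/2) to the right of an atom, the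
coefficients to its left: the solution is continuous and its derivative jumps
by (z omega + z^2 v) times its value. The ring [K] is R[i] for solutions at a
fixed z, and polynomials in z for the dependence on z. *)
Definition atom_step t u : K * K :=
  (u.1 + jump t * (u.1 + e (expR (- pos t)) * u.2),
   u.2 - jump t * (e (expR (pos t)) * u.1 + u.2)).

Definition transfer s u : K * K := foldr atom_step u s.

(** The Wronskian of two solutions, in terms of their coefficients. *)
Definition state_det u v : K := u.2 * v.1 - u.1 * v.2.

Definition state_swap u : K * K := (u.2, u.1).

Lemma state_swapK u : state_swap (state_swap u) = u.
Proof. by case: u. Qed.

Lemma expKN x : e (expR (- x)) * e (expR x) = 1.
Proof. by rewrite -rmorphM -expRD addNr expR0 rmorph1. Qed.

Lemma det_step t u v : state_det (atom_step t u) (atom_step t v) = state_det u v.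
Proof.
have E := expKN (pos t); rewrite /state_det /atom_step /=.
set h := jump t; set p := e _ in E *; set q := e _ in E *.
have -> : (u.2 - h * (q * u.1 + u.2)) * (v.1 + h * (v.1 + p * v.2)) -
  (u.1 + h * (u.1 + p * u.2)) * (v.2 - h * (q * v.1 + v.2)) =
  u.2 * v.1 - u.1 * v.2 + (u.1 * v.2 - u.2 * v.1) * (h ^+ 2 - h ^+ 2 * (p * q))
  by ring.
by rewrite E mulr1 subrr mulr0 addr0.
Qed.

(** The Wronskian of two solutions does not depend on the point. *)
Lemma det_transfer s u v : state_det (transfer s u) (transfer s v) = state_det u v.
Proof. by elim: s => //= t s IH; rewrite det_step. Qed.

Lemma transfer_cat s1 s2 u : transfer (s1 ++ s2) u = transfer s1 (transfer s2 u).
Proof. by rewrite /transfer foldr_cat. Qed.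

Lemma transfer_lin s a b u v :
  transfer s (a * u.1 + b * v.1, a * u.2 + b * v.2) =
  (a * (transfer s u).1 + b * (transfer s v).1,
   a * (transfer s u).2 + b * (transfer s v).2).
Proof.
elim: s => //= t s ->; rewrite /atom_step /=; congr (_, _); ring.
Qed.

Lemma transfer0 s : transfer s (0, 0) = (0, 0).
Proof. by elim: s => //= t s ->; rewrite /atom_step /= !(mulr0, addr0, subr0). Qed.

End Transfer.

Section Reflect.
Variable R : realType.
Implicit Types (t : R * R * R) (s : seq (R * R * R)).
Definition reflect1 t : R * R * R := (- pos t, womega t, wv t).
(** The reflection x -> - x turns the left half-line into a right half-line, so that
only one of them has to be studied. *)
Definition reflects s := rev (map reflect1 s).

Lemma reflect1K : involutive reflect1.
Proof. by case=> [[x o] v]; rewrite /reflect1 /pos /womega /wv /= opprK. Qed.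

Lemma reflectsK : involutive reflects.
Proof. by move=> s; rewrite /reflects map_rev revK mapK //; exact: reflect1K. Qed.

Variables (K : comNzRingType) (e : {rmorphism R -> K}) (z : K).

(** Reflection exchanges the two exponentials and reverses the direction in which an
atom is crossed, so it conjugates a step to the inverse of the step. *)
Lemma step_reflect t u :
  atom_step e z (reflect1 t) (state_swap (atom_step e z t u)) = state_swap u.
Proof.
have E := expKN e (pos t);
  rewrite /atom_step /state_swap /reflect1 /jump /pos /womega /wv /= opprK.
rewrite -/(pos t) -/(womega t) -/(wv t).
set h := z * _ + _; set p := e _ in E *; set q := e _ in E *.
congr (_, _).
  have -> : u.2 - h * (q * u.1 + u.2) + h * (u.2 - h * (q * u.1 + u.2) +
    q * (u.1 + h * (u.1 + p * u.2))) = u.2 + h ^+ 2 * u.2 * (p * q - 1) by ring.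
  by rewrite E subrr mulr0 addr0.
have -> : u.1 + h * (u.1 + p * u.2) - h * (p * (u.2 - h * (q * u.1 + u.2)) +
    (u.1 + h * (u.1 + p * u.2))) = u.1 + h ^+ 2 * u.1 * (p * q - 1) by ring.
by rewrite E subrr mulr0 addr0.
Qed.

Lemma transfer_reflects s u :
  transfer e z (reflects s) (state_swap (transfer e z s u)) = state_swap u.
Proof.
elim: s => //= t s IH; rewrite /reflects /= rev_cons /transfer foldr_rcons.
by rewrite step_reflect.
Qed.

Lemma transferK s u :
  transfer e z s (state_swap (transfer e z (reflects s) (state_swap u))) = u.
Proof.
by have := transfer_reflects (reflects s) (state_swap u); rewrite reflectsK => ->; case: u.
Qed.
End Reflect.

Section PolyState.
Variable R : realType.
Implicit Types (t : R * R * R) (s : seq (R * R * R)).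

(** The coefficients of phi_+(z, .) to the left of all the atoms of [s], as
polynomials in z. The second one is the Wronskian of phi_+ and phi_-. *)
Definition poly_state s : {poly R} * {poly R} := transfer polyC 'X s (0, 1).
Definition poly_jump t : {poly R} := jump polyC 'X t.

(** For atoms beyond [a], e^(a/2) phi_+(z, a) is [phi_poly a s], and [grow_poly a s]
is the part of it contributed by the growing exponential. The logarithmic
derivative of phi_+ at [a] is grow_poly / phi_poly - 1/2. *)
Definition grow_poly a s : {poly R} := (expR a)%:P * (poly_state s).1.
Definition phi_poly a s : {poly R} := (poly_state s).2 + grow_poly a s.

Definition valid_weights t := (0 <= wv t) && (0 < `|womega t| + wv t).

Lemma size_poly_jump t : valid_weights t -> (1 < size (poly_jump t))%N.
Proof.
case/andP=> v0 p; rewrite /poly_jump /jump.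
have -> : 'X * (womega t)%:P + 'X ^+ 2 * (wv t)%:P =
  'X * ((womega t)%:P + wv t *: 'X) by rewrite -mul_polyC; ring.
have nz : (womega t)%:P + wv t *: 'X != 0.
  apply/negP => /eqP E; have := congr1 (coefp 0) E; have := congr1 (coefp 1) E.
  rewrite /= !coefE /= !(mulr0, addr0, add0r, mulr1) => wv0 om0.
  by move: p; rewrite wv0 om0 normr0 addr0 ltxx.
by rewrite mulrC size_mulX // ltnS lt0n size_poly_eq0.
Qed.

Lemma poly_jump_inj t1 t2 : pos t1 = pos t2 -> poly_jump t1 = poly_jump t2 -> t1 = t2.
Proof.
case: t1 t2 => [[x1 o1] w1] [[x2 o2] w2].
rewrite /poly_jump /jump /pos /womega /wv /= => -> E.
have := congr1 (coefp 1) E; have := congr1 (coefp 2) E.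
by rewrite /= !coefE !eqxx /= !mul0r !add0r !addr0 !mul1r => -> ->.
Qed.

(** The jump is a polynomial of positive degree, so crossing an atom raises the
degree. *)
Lemma size_add_mul (h g v : {poly R}) : (1 < size h)%N -> g != 0 ->
  (size v <= size g)%N -> (size g < size (v + h * g)%R)%N.
Proof.
move=> h1 g0 vg; have h0 : h != 0 by apply/eqP => h0; rewrite h0 size_poly0 in h1.
have sg : (size g < size (h * g)%R)%N.
  by rewrite size_mul // -(subnKC h1) addSn /= addSn ltnS leq_addl.
by rewrite addrC size_polyDl // (leq_ltn_trans vg).
Qed.

Lemma poly_state_cons t s :
  let Y := grow_poly (pos t) s + poly_jump t * phi_poly (pos t) s in
  poly_state (t :: s) = ((expR (- pos t))%:P * Y, phi_poly (pos t) s - Y).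
Proof.
rewrite /poly_state /= -/(poly_state s) /phi_poly /grow_poly /atom_step -/(poly_jump t) /=.
have E := expKN polyC (pos t).
set h := poly_jump t; set p := _%:P in E *; set q := _%:P in E *.
set A := (poly_state s).1; set B := (poly_state s).2; congr (_, _); last by ring.
have -> : p * (q * A + h * (B + q * A)) = (p * q) * (A + h * A) + h * p * B by ring.
by rewrite E; ring.
Qed.

Lemma grow_poly_cons a t s :
  grow_poly a (t :: s) = (expR (a - pos t)) *: (grow_poly (pos t) s +
    poly_jump t * phi_poly (pos t) s).
Proof.
by rewrite {1}/grow_poly poly_state_cons /= mulrA -polyCM -expRD mul_polyC.
Qed.

Lemma phi_poly_cons a t s :
  phi_poly a (t :: s) = phi_poly (pos t) s
    - (1 - expR (a - pos t)) *: (grow_poly (pos t) s + poly_jump t * phi_poly (pos t) s).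
Proof.
by rewrite {1}/phi_poly grow_poly_cons poly_state_cons /= scalerBl scale1r opprB -addrA [- _ +
  _]addrC.
Qed.


Lemma phi_poly_horner0 a s : (phi_poly a s).[0] = 1 /\ (grow_poly a s).[0] = 0.
Proof.
have [A0 B0] : (poly_state s).1.[0] = 0 /\ (poly_state s).2.[0] = 1.
  elim: s => [|t s [IH1 IH2]]; first by rewrite /poly_state /= !hornerE.
  rewrite /poly_state /= -/(poly_state s) /atom_step /jump /=.
  by rewrite !(hornerE, IH1, IH2) expr0n /= !mul0r subr0.
by rewrite /phi_poly /grow_poly !hornerE A0 B0 mulr0 addr0.
Qed.

Lemma phi_poly_neq0 a s : phi_poly a s != 0.
Proof.
apply/eqP => K0; have [+ _] := phi_poly_horner0 a s.
by rewrite K0 horner0 => /eqP; rewrite eq_sym oner_eq0.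
Qed.

Lemma phi_poly_cons_size a t s :
  a < pos t -> valid_weights t -> (size (grow_poly (pos t) s) <= size (phi_poly (pos t) s))%N ->
  let Y := grow_poly (pos t) s + poly_jump t * phi_poly (pos t) s in
  (size (phi_poly (pos t) s) < size Y)%N /\ size (phi_poly a (t :: s)) = size Y.
Proof.
move=> ax vt sVK Y; have sKY := size_add_mul (size_poly_jump vt) (phi_poly_neq0 _ _) sVK.
split=> //; rewrite phi_poly_cons -/Y.
have l1 : 0 < 1 - expR (a - pos t) by rewrite subr_gt0 -expR0 ltr_expR subr_lt0.
by rewrite addrC size_polyDl size_polyN size_scale ?gt_eqF.
Qed.

(** At z = oo the nearest atom, at x, acts as a Dirichlet condition, because the jump
there is unbounded in z. So the quotient grow_poly / phi_poly tends to the value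
- c that belongs to the solution vanishing at x,
with c = e^(a - x) / (1 - e^(a - x)). *)
Lemma phi_grow_size a s : path <%R a (map (@pos R) s) -> all valid_weights s ->
  (size (grow_poly a s) <= size (phi_poly a s))%N /\
  exists2 c, 0 <= c & (size (grow_poly a s + c *: phi_poly a s)%R < size (phi_poly a s))%N.
Proof.
elim: s a => [|t s IH] a /=.
  move=> _ _; rewrite /phi_poly /grow_poly /poly_state /= mulr0 addr0 size_poly0 size_poly1;
    split=> //.
  by exists 0 => //; rewrite scale0r addr0 size_poly0.
move=> /andP[ax /IH {}IH] /andP[vt /IH [sVK _]].
have [sKY sK] := phi_poly_cons_size ax vt sVK.
set l := expR (a - pos t).
have l0 : 0 < l by exact: expR_gt0.
have l1 : 0 < 1 - l by rewrite subr_gt0 -expR0 ltr_expR subr_lt0.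
rewrite grow_poly_cons sK phi_poly_cons -/l; set Y := grow_poly _ s + _ in sKY *.
rewrite size_scale ?gt_eqF //; split=> //.
exists (l / (1 - l)); first by rewrite divr_ge0 // ltW.
rewrite scalerBr scalerA divfK ?gt_eqF // addrC subrK.
by rewrite (leq_ltn_trans (size_scale_leq _ _)).
Qed.

Lemma scale_cancel (l m : R) (p1 p2 q1 q2 : {poly R}) :
  p1 - (1 - l) *: q1 = p2 - (1 - m) *: q2 -> l *: q1 = m *: q2 ->
  p1 - p2 = q1 - q2.
Proof.
move=> /eqP; rewrite -subr_eq0 => /eqP E1 /eqP; rewrite -subr_eq0 => /eqP E2.
apply/eqP; rewrite -subr_eq0; apply/eqP.
transitivity (p1 - (1 - l) *: q1 - (p2 - (1 - m) *: q2) - (l *: q1 - m *: q2)).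
  by rewrite -!mul_polyC !polyCB polyC1; ring.
by rewrite E1 E2 subrr.
Qed.

(** The limit of grow_poly / phi_poly at z = oo gives the position of the nearest
atom. Just before that atom grow_poly is the jump times phi_poly, plus a term of
no larger degree than phi_poly; since the jump has no constant term, this gives
the weights. The remaining atoms follow by induction. *)
Lemma phi_grow_inj a s1 s2 :
  path <%R a (map (@pos R) s1) -> all valid_weights s1 ->
  path <%R a (map (@pos R) s2) -> all valid_weights s2 ->
  phi_poly a s1 = phi_poly a s2 -> grow_poly a s1 = grow_poly a s2 -> s1 = s2.
Proof.
have nc b t s : path <%R b (map (@pos R) (t :: s)) -> all valid_weights (t :: s) ->
    phi_poly b [::] <> phi_poly b (t :: s).
  move=> /= /andP[ax p] /andP[vt vs] /(congr1 (fun p : {poly R} => size p)).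
  have [sVK _] := phi_grow_size p vs.
  have [sKY ->] := phi_poly_cons_size ax vt sVK.
  rewrite {1}/phi_poly /grow_poly /poly_state /= mulr0 addr0 size_poly1 => e; move: sKY.
  by rewrite -e ltnS leqn0 size_poly_eq0 (negbTE (phi_poly_neq0 _ _)).
elim: s1 a s2 => [|t1 s1 IH] a [|t2 s2] // p1 v1 p2 v2.
- by move=> /(nc _ _ _ p2 v2).
- by move=> /esym /(nc _ _ _ p1 v1).
move: p1 v1 p2 v2 => /= /andP[a1 p1] /andP[vt1 v1] /andP[a2 p2] /andP[vt2 v2].
have [sVK1 _] := phi_grow_size p1 v1; have [sVK2 _] := phi_grow_size p2 v2.
have [sKY1 sK1] := phi_poly_cons_size a1 vt1 sVK1.
have [sKY2 sK2] := phi_poly_cons_size a2 vt2 sVK2.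
move=> EK EV; rewrite EK sK2 in sK1; clear sK2.
have l1 : 0 < expR (a - pos t1) by exact: expR_gt0.
have l2 : 0 < expR (a - pos t2) by exact: expR_gt0.
have := EV; have := EK; rewrite !phi_poly_cons !grow_poly_cons.
set l := expR (a - pos t1) in l1 *; set m := expR (a - pos t2) in l2 *.
set K1 := phi_poly _ s1 in sVK1 sKY1 sK1 *; set K2 := phi_poly _ s2 in sVK2 sKY2 sK1 *.
set Y1 := grow_poly _ s1 + _ in sKY1 sK1 *; set Y2 := grow_poly _ s2 + _ in sKY2 sK1 *.
move=> fK fV.
have fK' := scale_cancel fK fV.
have lm : l = m.
  apply/eqP; rewrite -subr_eq0; apply/negPn/negP => lm.
  have E : (m - l) *: Y2 = l *: (K1 - K2) by rewrite fK' scalerBr fV scalerBl.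
  have : (size ((m - l) *: Y2)%R < size Y2)%N.
    rewrite E (leq_ltn_trans (size_scale_leq _ _)) //.
    rewrite (leq_ltn_trans (size_polyD _ _)) // gtn_max size_polyN sKY2.
    by rewrite sK1 sKY1.
  by rewrite size_scale ?ltnn // -opprB oppr_eq0.
have EY : Y1 = Y2 by apply: (scalerI (lt0r_neq0 l1)); rewrite fV lm.
have EK12 : K1 = K2 by move: fK; rewrite EY lm => /addIr.
have x12 : pos t1 = pos t2.
  by move: lm => /expR_inj /addrI /oppr_inj.
have EV12 : grow_poly (pos t1) s1 - grow_poly (pos t2) s2 = (poly_jump t2 - poly_jump t1) * K1.
  move: EY; rewrite /Y1 /Y2 -/K2 -EK12 => /eqP; rewrite -subr_eq0 => /eqP EY.
  by rewrite mulrBl -[LHS]subr0 -EY; ring.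
have hh : poly_jump t1 = poly_jump t2.
  apply/eqP; rewrite eq_sym -subr_eq0; apply/negPn/negP => hh.
  have hs : (1 < size (poly_jump t2 - poly_jump t1)%R)%N.
    have E : poly_jump t2 - poly_jump t1 = 'X * ((womega t2 - womega t1)%:P +
      (wv t2 - wv t1) *: 'X).
      by rewrite /poly_jump /jump !polyCB -mul_polyC polyCB; ring.
    move: hh; rewrite E mulf_eq0 polyX_eq0 /= => hh.
    by rewrite mulrC size_mulX // ltnS lt0n size_poly_eq0.
  have := @size_add_mul _ K1 0 hs (phi_poly_neq0 _ _); rewrite size_poly0 add0r -EV12.
  move=> /(_ (leq0n _)); rewrite ltnNge; apply/negP; rewrite negbK.
  rewrite (leq_trans (size_polyD _ _)) // geq_max size_polyN sVK1 /=.
  by rewrite EK12.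
have EV' : grow_poly (pos t1) s1 = grow_poly (pos t1) s2.
  by apply/eqP; rewrite -subr_eq0 [X in _ - grow_poly X _]x12 EV12 hh subrr mul0r.
have -> : s1 = s2.
  apply: (IH (pos t1)) => //; first by rewrite x12.
  by rewrite -/K1 EK12 /K2 x12.
by congr (_ :: _); exact: poly_jump_inj x12 hh.
Qed.
End PolyState.

(** * Inverse problem on a half-line *)

Section Inverse.
Variable R : realType.

(** z^2 / (1 - k z) = (z / (1 - k z) - z) / k. *)
Lemma double_pole_split (k rho : R) (Kj K : {poly R}) : k != 0 ->
  K = (1 - k *: 'X) * Kj ->
  'X ^+ 2 * (rho *: Kj) = (rho / k) *: ('X * (Kj - K)).
Proof.
move=> k0 ->.
have -> : 'X * (Kj - (1 - k *: 'X) * Kj) = k *: ('X ^+ 2 * Kj).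
  by rewrite -!mul_polyC; ring.
by rewrite scalerA divfK // scalerAr.
Qed.

(** Each fraction z^2 / (1 - kap_j z) is the sum of a multiple of
z / (1 - kap_j z) and of a multiple of z, except that it is z^2 itself when
kap_j = 0. The polynomial terms are what an atom contributes: z for omega, z^2
for v. *)
Lemma resolve_double_poles n (kap rho : 'I_n -> R) :
  let S := [set j | kap j != 0] in
  'X ^+ 2 * \sum_j rho j *: recip_prod kap [set~ j] =
    residue_poly kap (fun j => rho j / kap j ^+ 2) S
    + ((\sum_(j in ~: S) rho j) *: 'X ^+ 2 - (\sum_(j in S) rho j / kap j) *: 'X)
       * recip_prod kap finset.setT.
Proof.
move=> S; have K1 j : recip_prod kap finset.setT = (1 - kap j *: 'X) * recip_prod kap [set~ j].
  by rewrite (@recip_prodD1 _ _ _ _ j) ?inE // finset.setTD.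
rewrite (bigID (mem S)) /= mulrDr mulrBl [RHS]addrCA [RHS]addrC; congr (_ + _); last first.
  rewrite scaler_suml mulr_suml mulr_sumr.
  rewrite [RHS](eq_bigl (fun j => j \notin S)) => [|j]; last by rewrite inE.
  apply: eq_bigr => j; rewrite inE negbK => /eqP k0.
  by rewrite (K1 j) k0 scale0r subr0 mul1r -scalerAr scalerAl.
rewrite /residue_poly mulr_sumr scaler_suml mulr_suml mulr_sumr -sumrB; apply: eq_bigr => j jS.
have k0 : kap j != 0 by rewrite inE in jS.
rewrite (double_pole_split _ k0 (K1 j)).
have -> : recip_prod kap (S :\ j) = recip_prod kap [set~ j].
  apply/esym/recip_prod_support; first by apply/fintype.subsetP => i; rewrite !inE => /andP[].
  by move=> i; rewrite !inE => ->; rewrite negbK => /eqP.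
rewrite (_ : rho j / kap j ^+ 2 * kap j = rho j / kap j); last by field.
by rewrite mulrBr scalerBr scalerAr scalerAl.
Qed.

(** One step of a continued fraction. With C the sum of the residues, the limit at
z = oo forces the first atom to lie at x with e^(x - a) = (C + 1) / C. The
function e^(x/2) phi_+(z, x) is then K' = sum_j r_j K_j / C, where K_j is the
product K without its j-th factor; its roots interlace those of K. The expansion
of K over K' consists of a jump, which has to be the one at x, and of fractions
with positive residues, which describe the rest of the string and are fewer in
number. The weight v at x is nonnegative because it is the coefficient that
belongs to a root of K' at infinity, or 0. *)
Theorem string_of_residues n (kap r : 'I_n -> R) (a : R) :
  injective kap -> (forall j, kap j != 0) -> (forall j, 0 < r j) ->
  exists s, [/\ path <%R a (map (@pos R) s), all (@valid_weights R) s,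
    phi_poly a s = recip_prod kap finset.setT & grow_poly a s = residue_poly kap r finset.setT].
Proof.
move: {2}n.+1 (ltnSn n) => k; elim: k n kap r a => // k IH [|n] kap r a nk inj k0 r0.
  exists [::]; split=> //.
    rewrite /phi_poly /grow_poly /poly_state /= mulr0 addr0 /recip_prod big1 // => -[[]] //.
  by rewrite /grow_poly /poly_state /= mulr0 /residue_poly big1 ?mulr0 // => -[[]].
have [tau [kap' [rho [b [tinj tmon kapin E [inj' rho0 F]]]]]] := interlace_recip inj r0.
set C := \sum_i r i in E.
have C0 : 0 < C.
  by rewrite /C (bigD1 ord0) //= ltr_pwDl // sumr_ge0 // => i _; exact: ltW.
set K' := recip_prod kap' finset.setT in E F; set K := recip_prod kap finset.setT in F *.
pose S := [set j | kap' j != 0].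
(* the position for which the solution vanishing at x has the right limit at z = oo *)
pose x := a + ln ((C + 1) / C).
have xE : expR (a - x) = C / (C + 1).
  by rewrite /x opprD addrA subrr add0r expRN lnK ?invf_div // posrE divr_gt0 // addr_gt0.
have ax : a < x.
  by rewrite ltrDl ln_gt0 // ltr_pdivlMr // mul1r ltrDl.
pose r' j := (C + 1) * (rho j / kap' j ^+ 2).
have C1 : 0 < C + 1 by rewrite addr_gt0.
have r'0 j : j \in S -> 0 < r' j.
  by rewrite inE => kj; rewrite mulr_gt0 // divr_gt0 // exprn_even_gt0.
have [|||| s [ps vs sK sV]] := IH #|S| (fun l : 'I_#|S| => kap' (enum_val l))
    (fun l => r' (enum_val l)) x.
- by rewrite (leq_ltn_trans (max_card _)) // card_ord.
- by move=> i j /inj' /enum_val_inj.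
- by move=> i; have := enum_valP i; rewrite inE.
- by move=> i; apply/r'0/enum_valP.
rewrite recip_prod_enum in sK; rewrite residue_poly_enum in sV.
have KS : recip_prod kap' S = K'.
  by apply/esym/recip_prod_support => // j _; rewrite inE negbK => /eqP.
rewrite KS in sK.
pose om := (C + 1) * (b - \sum_(j in S) rho j / kap' j).
pose v := (C + 1) * \sum_(j in ~: S) rho j.
pose t : R * R * R := (x, om, v).
have YE : grow_poly x s + poly_jump t * phi_poly x s = (C + 1) *: (K' - K).
  rewrite sV sK F (resolve_double_poles kap' rho) -/S -/K'.
  have -> : residue_poly kap' r' S = (C + 1) *: residue_poly kap' (fun j =>
    rho j / kap' j ^+ 2) S.
    rewrite /residue_poly scalerAr scaler_sumr; congr (_ * _); apply: eq_bigr => j _.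
    by rewrite scalerA /r' !mulrA.
  rewrite /poly_jump /jump /t /womega /wv /= /om /v !(polyCM, polyCB) -!mul_polyC.
  set V' := residue_poly _ _ _; set P := (\sum_(j in ~: S) rho j)%:P; set Q :=
    (\sum_(j in S) _)%:P.
  ring.
have EC : C *: K' = C *: K + residue_poly kap r finset.setT.
  rewrite -E /residue_poly /C scaler_suml mulr_sumr.
  rewrite [X in _ = _ + X](eq_bigl xpredT) => [|j]; last by rewrite inE.
  rewrite -big_split /=; apply: eq_bigr => j _.
  rewrite /K (@recip_prodD1 _ _ kap finset.setT j) ?inE // finset.setTD -!mul_polyC polyCM; ring.
(* if both weights were 0, K would be a combination of polynomials of
   degree at most n *)
have vt : valid_weights t.
  have v0 : 0 <= v.
    by apply: mulr_ge0; [exact: ltW | apply: sumr_ge0 => j _; exact: ltW].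
  rewrite /valid_weights /wv /womega /= v0 /= lt_neqAle addr_ge0 // andbT eq_sym.
  apply/negP; rewrite paddr_eq0 // normr_eq0 => /andP[/eqP om0 /eqP v00].
  have : (C + 1) *: K = (C + 1) *: K' - grow_poly x s.
    have -> : grow_poly x s = (C + 1) *: (K' - K).
      by rewrite -YE /poly_jump /jump /t /womega /wv /= om0 v00 !mulr0 addr0 mul0r addr0.
    by rewrite scalerBr subKr.
  move=> /(congr1 (fun p : {poly R} => size p)); rewrite size_scale ?gt_eqF //.
  rewrite size_recip_prod // cardsT card_ord => e.
  have : (n.+2 <= n.+1)%N; last by rewrite ltnn.
  rewrite e (leq_trans (size_polyD _ _)) // size_polyN geq_max.
  rewrite (leq_trans (size_scale_leq _ _)) ?sV /=; last first.
    by rewrite (leq_trans (size_recip_prod_leq _ _)) // cardsT card_ord.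
  by rewrite (leq_trans (size_residue_poly_leq _ _ _)) // ltnS (leq_trans (max_card _)) // card_ord.
exists (t :: s); split.
- by rewrite /= ax ps.
- by rewrite /= vt vs.
- rewrite phi_poly_cons [pos t]/= YE scalerA xE sK.
  rewrite (_ : (1 - C / (C + 1)) * (C + 1) = 1); last by field; rewrite gt_eqF.
  by rewrite scale1r subKr.
rewrite grow_poly_cons [pos t]/= YE scalerA xE divfK ?gt_eqF // scalerBr EC addrAC subrr add0r //.
Qed.
End Inverse.

(** * Wronskian and norming constants *)

Section Split.
Variable R : realType.
Implicit Types (t : R * R * R) (s L M Q : seq (R * R * R)).

Lemma poly_state_phi_poly a s : poly_state s = ((expR (- a))%:P * grow_poly a s,
  phi_poly a s - grow_poly a s).
Proof.
rewrite /phi_poly addrK /grow_poly mulrA -polyCM -expRD addNr expR0 polyC1 mul1r.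
by case: (poly_state s).
Qed.

(** The coefficients of phi_-(z, .) to the right of the atoms of [L]. *)
Definition left_state L : {poly R} * {poly R} := state_swap (poly_state (reflects L)).

Lemma left_stateE a L : left_state L =
  (phi_poly (- a) (reflects L) - grow_poly (- a) (reflects L),
    (expR a)%:P * grow_poly (- a) (reflects L)).
Proof. by rewrite /left_state (poly_state_phi_poly (- a)) /state_swap /= opprK. Qed.

Lemma transfer_left_state L : transfer polyC 'X L (left_state L) = (1, 0).
Proof. exact: (@transferK _ _ _ _ L (1, 0)). Qed.

Definition total_jump M : {poly R} := \sum_(t <- M) poly_jump t.

Lemma mid_state a M Q : (size M <= 1)%N -> all (fun t => pos t == a) M ->
  transfer polyC 'X M (poly_state Q) =
  ((expR (- a))%:P * (grow_poly a Q + total_jump M * phi_poly a Q),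
   phi_poly a Q - (grow_poly a Q + total_jump M * phi_poly a Q)).
Proof.
case: M => [|t [|//]] _ /=.
  by rewrite /total_jump big_nil mul0r addr0 -poly_state_phi_poly.
rewrite andbT => /eqP <-; rewrite -[atom_step _ _ _ _]/(poly_state (t :: Q)).
by rewrite poly_state_cons /total_jump big_seq1.
Qed.

(** The Wronskian of phi_+ and phi_-, evaluated just to the left of [a]. *)
Lemma wronskian_split a L M Q : (size M <= 1)%N -> all (fun t => pos t == a) M ->
  let K := phi_poly a Q in let V := grow_poly a Q in
  let K' := phi_poly (- a) (reflects L) in let V' := grow_poly (- a) (reflects L) in
  (poly_state (L ++ M ++ Q)).2 = K * K' - K * V' - V * K' - total_jump M * K * K'.
Proof.
move=> sM aM K V K' V'.
have := det_transfer polyC 'X L (transfer polyC 'X M (poly_state Q)) (left_state L).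
rewrite transfer_left_state (left_stateE a) /poly_state -!transfer_cat -!catA -/(poly_state _) /state_det /=.
rewrite mulr0 subr0 mulr1 => ->.
rewrite transfer_cat -/(poly_state Q) (mid_state _ sM aM) /=.
rewrite -/K -/V -/K' -/V'; set h := total_jump M.
have E := expKN polyC a; set p := _%:P in E *; set q := _%:P in E *.
have -> : p * (V + h * K) * (q * V') = (p * q) * ((V + h * K) * V') by ring.
by rewrite E; ring.
Qed.

(** Writing the solution phi_+ to the left of all atoms as A e^(x/2) + W e^(-x/2) and
transporting both terms to [a] gives phi_+ = A phi_- modulo W. *)
Lemma phi_split a L M Q : (size M <= 1)%N -> all (fun t => pos t == a) M ->
  exists q : {poly R},
  phi_poly a Q = expR a *: ((poly_state (L ++ M ++ Q)).1 * phi_poly (- a) (reflects L))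
           + (poly_state (L ++ M ++ Q)).2 * q.
Proof.
move=> sM aM; set U := poly_state _.
pose v2 := state_swap (transfer polyC 'X (reflects L) (1, 0)).
exists (v2.2 + (expR a)%:P * v2.1).
have T2 : transfer polyC 'X L v2 = (0, 1) by exact: (@transferK _ _ _ _ L (0, 1)).
pose u2 := transfer polyC 'X M (poly_state Q).
have UE : U = transfer polyC 'X L u2 by rewrite /U /u2 /poly_state !transfer_cat.
have u2E : u2 = (U.1 * (left_state L).1 + U.2 * v2.1, U.1 * (left_state L).2 + U.2 * v2.2).
  set w := (_, _).
  have Tw : transfer polyC 'X L w = U.
    rewrite /w transfer_lin transfer_left_state T2 /= !(mulr0, mulr1, addr0, add0r).
    by rewrite -surjective_pairing.
  have E : state_swap u2 = state_swap w.
    by rewrite -(transfer_reflects polyC 'X L u2) -UE -Tw transfer_reflects.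
  by rewrite -[LHS]state_swapK E state_swapK.
have : u2.2 + (expR a)%:P * u2.1 = phi_poly a Q.
  rewrite /u2 (mid_state _ sM aM) /= mulrA -polyCM -expRD subrr expR0 mul1r.
  by rewrite subrK.
move=> <-; rewrite u2E (left_stateE a) /= -mul_polyC.
set K' := phi_poly _ _; set V' := grow_poly _ _; ring.
Qed.

(** At an eigenvalue, the integral that defines gamma^2. *)
Fixpoint gamma_poly s : {poly R} := if s is t :: s' then
   gamma_poly s' + ((womega t)%:P +
     (2 * wv t) *: 'X) * (expR (- pos t) *: phi_poly (pos t) s' ^+ 2)
  else 0.

Lemma deriv_poly_jump t : (poly_jump t)^`() = (womega t)%:P + (2 * wv t) *: 'X.
Proof.
rewrite /poly_jump /jump derivD !derivM derivX !derivC -!mul_polyC polyCM.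
rewrite (_ : 2%:P = 1 + 1) ?polyCD //; ring.
Qed.

(** The left-hand side is the Wronskian of phi_+ and its derivative in z. It vanishes
to the right of all atoms, and crossing an atom changes it by the derivative of
the jump times the square of phi_+. *)
Lemma gamma_polyE s :
  (poly_state s).1 * (poly_state s).2^`() - (poly_state s).1^`() * (poly_state s).2 =
    - gamma_poly s.
Proof.
elim: s => [|t s IH]; first by rewrite /poly_state /= mul0r deriv0 mul0r subrr oppr0.
rewrite [gamma_poly _]/= opprD -IH poly_state_cons (poly_state_phi_poly (pos t) s) -deriv_poly_jump.
move: (phi_poly _ _) (grow_poly _ _) (poly_jump t) => K V h /=.
by rewrite -mul_polyC !(derivM, derivD, derivB, derivC, derivN); ring.
Qed.
End Split.

(** * The differential equation between atoms *)

Section RealODE.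
Local Open Scope classical_set_scope.
Local Open Scope ring_scope.
Variable R : realType.

Definition expcomb (al be x : R) : R :=
  al * expR (2^-1 * x) + be * expR (- 2^-1 * x).

Lemma is_derive_exp_scale (k x : R) :
  is_derive x 1 (fun y : R => expR (k * y)) (k * expR (k * x)).
Proof.
have H : is_derive x (1:R) (k \*: (id : R -> R)) (k *: (1:R)) by typeclasses eauto.
have := @is_derive1_comp R expR _ x _ _ (is_derive_expR (k * x)) H.
by rewrite /GRing.scale /= mulr1 mulrC.
Qed.

Lemma is_derive_expcomb (al be x : R) :
  is_derive x 1 (expcomb al be) (expcomb (al / 2) (- be / 2) x).
Proof.
have h1 := is_deriveZ al (is_derive_exp_scale (2^-1) x).
have h2 := is_deriveZ be (is_derive_exp_scale (- 2^-1) x).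
have h := is_deriveD h1 h2.
apply: (is_derive_eq h); rewrite /expcomb /GRing.scale /=; lra.
Qed.

Lemma derivable_expcomb (al be x : R) : derivable (expcomb al be) x 1.
Proof. by have [] := is_derive_expcomb al be x. Qed.

Lemma derive1_expcomb al be : derive1 (expcomb al be) = expcomb (al / 2) (- be / 2).
Proof.
by apply/funext => x; rewrite derive1E; have [_ ->] := is_derive_expcomb al be x.
Qed.

Lemma continuous_expcomb al be : continuous (expcomb al be).
Proof.
move=> x; apply/differentiable_continuous/derivable1_diffP; exact: derivable_expcomb.
Qed.

(** Covers bounded and unbounded intervals alike. *)
Definition convex_pred (D : R -> Prop) := forall x y w, D x -> D y -> x < w < y -> D w.

Lemma derive0_cst (D : R -> Prop) (g : R -> R) : convex_pred D ->
  (forall x, D x -> is_derive x 1 g 0) -> forall x y, D x -> D y -> g x = g y.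
Proof.
move=> cD dg.
have H x y : D x -> D y -> x < y -> g x = g y.
  move=> Dx Dy xy.
  have dg' w : w \in `[x, y] -> is_derive w 1 g 0.
    rewrite in_itv /= => /andP[]; rewrite le_eqVlt => /predU1P[<- _|xw]; first exact: dg.
    rewrite le_eqVlt => /predU1P[->|wy]; first exact: dg.
    by apply/dg/(cD x y) => //; rewrite xw.
  have dgo w : w \in `]x, y[ -> is_derive w 1 g ((fun=> 0) w).
    by rewrite in_itv /= => xwy; apply/dg/(cD x y).
  have cg : {within `[x, y], continuous g}.
    by apply: derivable_within_continuous => w /dg' [].
  have [c _ /eqP] := @MVT _ g (fun=> 0) x y xy dgo cg.
  by rewrite mul0r subr_eq0 => /eqP.
move=> x y Dx Dy; case: (ltgtP x y) => [||-> //]; first exact: H.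
by move=> yx; rewrite (H y x).
Qed.

(** The functions e^(-x/2) (u/2 + u') and e^(x/2) (u/2 - u') have derivative 0. *)
Lemma real_ode (D : R -> Prop) (u : R -> R) : convex_pred D ->
  (forall x, D x -> [/\ derivable u x 1, derivable (derive1 u) x 1 &
     derive1 (derive1 u) x = 4^-1 * u x]) ->
  exists al be, forall x, D x ->
    u x = expcomb al be x /\ derive1 u x = expcomb (al / 2) (- be / 2) x.
Proof.
move=> cD H.
have key (sg : R) : sg ^+ 2 = 1 -> forall x y, D x -> D y ->
  expR (- (sg / 2) * x) * (2^-1 * u x + sg * derive1 u x) =
  expR (- (sg / 2) * y) * (2^-1 * u y + sg * derive1 u y).
  move=> sg2 x y Dx Dy.
  pose g x := expR (- (sg / 2) * x) * (2^-1 * u x + sg * derive1 u x).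
  suff dg w : D w -> is_derive w 1 g 0 by exact: (derive0_cst cD dg).
  move=> {x y Dx Dy} /[dup] Dw; move: w Dw => x Dx _.
  have [du du' E] := H x Dx.
  have h1 : is_derive x 1 u (derive1 u x) by rewrite derive1E; exact: DeriveDef.
  have h2 : is_derive x 1 (derive1 u) (4^-1 * u x) by rewrite -E derive1E; apply: DeriveDef.
  have h := is_deriveM (is_derive_exp_scale (- (sg / 2)) x)
    (is_deriveD (is_deriveZ 2^-1 h1) (is_deriveZ sg h2)).
  apply: (is_derive_eq h); rewrite /GRing.scale /=.
  set p := expR _; set v := derive1 u x; set w := u x.
  transitivity ((1 - sg ^+ 2) * (p * v / 2)); last by rewrite sg2 subrr mul0r.
  by rewrite [X in _ + X * _](_ : _ = 2^-1 * w + sg * v) //; field.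
have [[x0 Dx0]|nD] := EM (exists x, D x); last first.
  by exists 0, 0; move=> x Dx; case: nD; exists x.
exists (expR (- (1 / 2) * x0) * (2^-1 * u x0 + 1 * derive1 u x0)),
  (expR (- (-1 / 2) * x0) * (2^-1 * u x0 + (-1) * derive1 u x0)); move=> x Dx.
rewrite (key 1 _ x0 x) ?expr1n // (key (-1) _ x0 x) ?sqrrN ?expr1n //.
have E : expR (- 2^-1 * x) * expR (2^-1 * x) = 1.
  by rewrite -expRD mulNr addNr expR0.
have e1 : - (1 / 2) = - 2^-1 :> R by lra.
have e2 : - (-1 / 2) = 2^-1 :> R by lra.
rewrite /expcomb e1 e2.
set p := expR _ in E *; set q := expR _ in E *; set v := derive1 u x; set w := u x.
split.
  transitivity ((p * q) * w); first by rewrite E mul1r.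
  by field.
transitivity ((p * q) * v); first by rewrite E mul1r.
by field.
Qed.
End RealODE.

Section ComplexODE.
Local Open Scope classical_set_scope.
Local Open Scope ring_scope.
Variable R : realType.
Notation C := (R[i]).

Definition cexpcomb (A B : C) (x : R) : C :=
  A * (expR (2^-1 * x))%:C + B * (expR (- 2^-1 * x))%:C.

Definition dcexpcomb (A B : C) := cexpcomb ((2^-1)%:C * A) (- ((2^-1)%:C * B)).

Lemma re_cexpcomb A B : re (cexpcomb A B) = expcomb (complex.Re A) (complex.Re B).
Proof.
apply/funext => x; rewrite /re /cexpcomb /expcomb; case: A B => [a a'] [b b'] /=.
by rewrite !mulr0 !subr0.
Qed.

Lemma im_cexpcomb A B : im (cexpcomb A B) = expcomb (complex.Im A) (complex.Im B).
Proof.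
apply/funext => x; rewrite /im /cexpcomb /expcomb; case: A B => [a a'] [b b'] /=.
by rewrite !mulr0 !add0r.
Qed.

Lemma deriveC_cexpcomb A B : deriveC (cexpcomb A B) = dcexpcomb A B.
Proof.
apply/funext => x; rewrite /deriveC re_cexpcomb im_cexpcomb !derive1_expcomb.
apply/eqP; rewrite eq_complex; apply/andP; split; apply/eqP.
  rewrite -[RHS]/(re (dcexpcomb A B) x) re_cexpcomb /= /expcomb; case: A B => [a a'] [b b'] /=.
  by rewrite !mul0r !subr0; lra.
rewrite -[RHS]/(im (dcexpcomb A B) x) im_cexpcomb /= /expcomb; case: A B => [a a'] [b b'] /=.
by rewrite !mul0r !addr0; lra.
Qed.

Lemma deriveC_dcexpcomb A B x : deriveC (dcexpcomb A B) x = (4%:R^-1)%:C * cexpcomb A B x.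
Proof.
rewrite /dcexpcomb deriveC_cexpcomb /dcexpcomb /cexpcomb !mulrN opprK mulrDr !mulrA -!rmorphM /=.
by rewrite (_ : 2^-1 * 2^-1 = 4%:R^-1) //; lra.
Qed.

Lemma derivableC_cexpcomb A B x : derivableC (cexpcomb A B) x.
Proof. by split; rewrite ?re_cexpcomb ?im_cexpcomb; exact: derivable_expcomb. Qed.

Lemma continuousC_cexpcomb A B : continuousC (cexpcomb A B).
Proof. by split; rewrite ?re_cexpcomb ?im_cexpcomb; exact: continuous_expcomb. Qed.

Lemma derivableC_near (f g : R -> C) x : (\forall y \near x, f y = g y) ->
  derivableC g x -> derivableC f x.
Proof.
move=> fg [h1 h2]; split; [apply: near_eq_derivable h1|apply: near_eq_derivable h2].
  by near=> y; rewrite /re; congr complex.Re; apply/esym; near: y.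
by near=> y; rewrite /im; congr complex.Im; apply/esym; near: y.
Unshelve. all: by end_near. Qed.

Lemma deriveC_near (f g : R -> C) (x : R) : (\forall y \near x, f y = g y) ->
  deriveC f x = deriveC g x :> C.
Proof.
move=> fg; rewrite /deriveC !derive1E; congr (_ +i* _); apply: near_eq_derive.
  by near=> y; rewrite /re; congr complex.Re; near: y.
by near=> y; rewrite /im; congr complex.Im; near: y.
Unshelve. all: by end_near. Qed.

Lemma deriveC_near2 (f g : R -> C) (x : R) : (\forall y \near x, f y = g y) ->
  \forall y \near x, deriveC f y = deriveC g y :> C.
Proof.
move=> /near_join; apply: filterS => y; exact: deriveC_near.
Qed.

Lemma ode_near (f : R -> C) A B (x : R) : (\forall y \near x, f y = cexpcomb A B y) ->
  [/\ derivableC f x, derivableC (deriveC f) x &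
      - deriveC (deriveC f) x + (4%:R^-1)%:C * f x = 0].
Proof.
move=> fE; have dfE := deriveC_near2 fE; rewrite deriveC_cexpcomb in dfE.
split; first exact: derivableC_near fE (derivableC_cexpcomb _ _ _).
  exact: derivableC_near dfE (derivableC_cexpcomb _ _ _).
by rewrite (deriveC_near dfE) deriveC_dcexpcomb (nbhs_singleton fE) addNr.
Qed.

Lemma ode_on (D : R -> Prop) (f : R -> C) : convex_pred D ->
  (forall x, D x -> [/\ derivableC f x, derivableC (deriveC f) x &
      - deriveC (deriveC f) x + (4%:R^-1)%:C * f x = 0]) ->
  exists A B, forall x, D x -> f x = cexpcomb A B x /\ deriveC f x = dcexpcomb A B x.
Proof.
move=> cD H.
have reE : re (deriveC f) = derive1 (re f) by [].
have imE : im (deriveC f) = derive1 (im f) by [].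
have [al [be Hre]] : exists al be, forall x, D x ->
    re f x = expcomb al be x /\ derive1 (re f) x = expcomb (al / 2) (- be / 2) x.
  apply: real_ode cD _ => x /H [[h1 _] [h2 _] E]; split=> //.
  move/eqP: E; rewrite addrC subr_eq0 => /eqP /(congr1 (@complex.Re R)).
  by rewrite /deriveC /= /re; case: (f x) => [a b] /= <-; rewrite mul0r subr0.
have [al' [be' Him]] : exists al be, forall x, D x ->
    im f x = expcomb al be x /\ derive1 (im f) x = expcomb (al / 2) (- be / 2) x.
  apply: real_ode cD _ => x /H [[_ h1] [_ h2] E]; split=> //.
  move/eqP: E; rewrite addrC subr_eq0 => /eqP /(congr1 (@complex.Im R)).
  by rewrite /deriveC /= /im; case: (f x) => [a b] /= <-; rewrite mul0r addr0.
exists (al +i* al'), (be +i* be'); move=> x Dx.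
have [r1 r2] := Hre x Dx; have [i1 i2] := Him x Dx.
rewrite -deriveC_cexpcomb; split.
  have -> : f x = re f x +i* im f x by rewrite /re /im; case: (f x).
  rewrite r1 i1 (_ : cexpcomb _ _ x =
    re (cexpcomb (al +i* al') (be +i* be')) x +i* im (cexpcomb (al +i* al') (be +i* be')) x).
    by rewrite re_cexpcomb im_cexpcomb.
  by rewrite /re /im; case: (cexpcomb _ _ x).
by rewrite /deriveC r2 i2 re_cexpcomb im_cexpcomb !derive1_expcomb.
Qed.

(** Half the value plus or minus the derivative isolates one of the two exponentials. *)
Lemma step_cexpcomb (z : C) t (u w : C * C) :
  w = atom_step (real_complex R) z t u <->
  cexpcomb w.1 w.2 (pos t) = cexpcomb u.1 u.2 (pos t) /\
  dcexpcomb w.1 w.2 (pos t) = dcexpcomb u.1 u.2 (pos t)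
    + jump (real_complex R) z t * cexpcomb u.1 u.2 (pos t).
Proof.
set h := jump _ _ _; set x := pos t.
pose q := real_complex R (expR (2^-1 * x)).
pose p := real_complex R (expR (- 2^-1 * x)).
have e1 : real_complex R (expR (- x)) = p * p.
  by rewrite /p -rmorphM -expRD -mulrDl (_ : - 2^-1 - 2^-1 = -1) ?mulN1r //; lra.
have e2 : real_complex R (expR x) = q * q.
  by rewrite /q -rmorphM -expRD -mulrDl (_ : 2^-1 + 2^-1 = 1) ?mul1r //; lra.
have E : q * p = 1 by rewrite -rmorphM -expRD mulNr subrr expR0 rmorph1.
have half : real_complex R 2^-1 = 2^-1 by rewrite fmorphV rmorph_nat.
have -> : atom_step (real_complex R) z t u =
    (u.1 + h * (u.1 + p * p * u.2), u.2 - h * (q * q * u.1 + u.2)).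
  by rewrite /atom_step -e1 -e2.
rewrite /dcexpcomb /cexpcomb half -/q -/p; move: h q p E {e1 e2} => h q p E;  case: w u =>
  [A' B'] [A B] /=; split.
  move=> [-> ->]; split; apply/eqP; rewrite -subr_eq0; apply/eqP.
    transitivity (h * (A * q - B * p) * (1 - q * p)); first by ring.
    by rewrite E subrr mulr0.
  transitivity (2^-1 * h * (A * q + B * p) * (q * p - 1)); first by field.
  by rewrite E subrr mulr0.
move=> [E1 E2]; congr (_, _).
  transitivity (p * (2^-1 * (A' * q + B' * p) + (2^-1 * A' * q + - (2^-1 * B') * p))
      + A' * (1 - q * p)); first by field.
  rewrite E1 E2 E; transitivity (A + h * (A + p * p * B) + (A + h * A) * (q * p - 1)).
    by field.
  by rewrite E subrr mulr0 addr0.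
transitivity (q * (2^-1 * (A' * q + B' * p) - (2^-1 * A' * q + - (2^-1 * B') * p))
    + B' * (1 - q * p)); first by field.
rewrite E1 E2 E; transitivity (B - h * (q * q * A + B) + (B - h * B) * (q * p - 1)).
  by field.
by rewrite E subrr mulr0 addr0.
Qed.
End ComplexODE.

(** * Solutions of the jump problem *)

Section Piecewise.
Local Open Scope classical_set_scope.
Local Open Scope ring_scope.
Variable R : realType.
Notation C := (R[i]).
Implicit Types (t : R * R * R) (s : seq (R * R * R)) (u v w : C * C).

Definition ctransfer (z : C) s u := transfer (real_complex R) z s u.

(** The solution with coefficients [u] to the right of all atoms: at x the
coefficients are obtained by crossing the atoms beyond x. *)
Definition piecewise_sol (z : C) s u (x : R) : C :=
  let v := ctransfer z [seq t <- s | x < pos t] u in cexpcomb v.1 v.2 x.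

(** Near x the set of atoms to be crossed is constant on each side; only an atom at x
itself makes a difference. *)
Lemma near_atoms_beyond s (x : R) : \forall y \near x,
  (x <= y -> [seq t <- s | y < pos t] = [seq t <- s | x < pos t]) /\
  (y < x -> [seq t <- s | y < pos t] = [seq t <- s | x <= pos t]).
Proof.
elim: s => [|t s IH]; first by near=> y; split.
have H : \forall y \near x, (x <= y -> (y < pos t) = (x < pos t)) /\
    (y < x -> (y < pos t) = (x <= pos t)).
  case: (ltgtP x (pos t)) => [xt|tx|<-].
  - apply: filterS (lt_nbhsl xt) => y yt; by split=> [_|yx]; rewrite yt.
  - apply: filterS (lt_nbhsr tx) => y ty; by split=> [_|yx]; rewrite (lt_gtF ty).
  by near=> y; split=> [|->//]; rewrite leNgt => /negbTE.
rewrite /=; near=> y.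
have [H1 H2] : (x <= y -> (y < pos t) = (x < pos t)) /\ (y < x -> (y < pos t) = (x <= pos t)).
  by near: y.
have [I1 I2] : (x <= y -> [seq t <- s | y < pos t] = [seq t <- s | x < pos t]) /\
  (y < x -> [seq t <- s | y < pos t] = [seq t <- s | x <= pos t]) by near: y.
by split=> xy; [rewrite H1 // I1 | rewrite H2 // I2].
Unshelve. all: by end_near. Qed.

Lemma filter_not_atom s (x : R) : x \notin map (@pos R) s ->
  [seq t <- s | x <= pos t] = [seq t <- s | x < pos t].
Proof.
move=> xs; apply: eq_in_filter => t ts; rewrite le_eqVlt.
by case: eqP => //= E; case/negP: xs; rewrite E map_f.
Qed.

Lemma filter_atom s t : sorted <%R (map (@pos R) s) -> t \in s ->
  [seq r <- s | pos t <= pos r] = t :: [seq r <- s | pos t < pos r].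
Proof.
elim: s => //= t' s IH; rewrite (path_sortedE lt_trans) => /andP[/allP ls ss].
rewrite inE => /predU1P[E|ts].
  rewrite E lexx ltxx; congr (_ :: _); apply: eq_in_filter => r rs.
  by have := ls _ (map_f _ rs) => h; rewrite h ltW.
have h := ls _ (map_f _ ts); rewrite leNgt h /= ltNge ltW //=; exact: IH.
Qed.

Lemma piecewise_sol_match z s u (x : R) : sorted <%R (map (@pos R) s) ->
  let v := ctransfer z [seq t <- s | x < pos t] u in
  let w := ctransfer z [seq t <- s | x <= pos t] u in
  cexpcomb w.1 w.2 x = cexpcomb v.1 v.2 x.
Proof.
move=> ss v w; have [|xs] := boolP (x \in map (@pos R) s); last first.
  by rewrite /w filter_not_atom.
case/mapP => t ts xt; have : w = atom_step (real_complex R) z t v.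
  by rewrite /w xt filter_atom // -xt.
by move/step_cexpcomb => [+ _]; rewrite -xt.
Qed.

Lemma piecewise_sol_near z s u (x : R) : \forall y \near x,
  (x <= y -> piecewise_sol z s u y = (let v :=
    ctransfer z [seq t <- s | x < pos t] u in cexpcomb v.1 v.2 y)) /\
  (y < x -> piecewise_sol z s u y = (let w :=
    ctransfer z [seq t <- s | x <= pos t] u in cexpcomb w.1 w.2 y)).
Proof.
apply: filterS (near_atoms_beyond s x) => y [h1 h2].
by split=> xy; rewrite /piecewise_sol; [rewrite h1 | rewrite h2].
Qed.

Lemma near_left (P : R -> Prop) (x : R) :
  (\forall y \near x, y < x -> P y) -> \forall y \near x^'-, P y.
Proof. by []. Qed.

Lemma near_right (P : R -> Prop) (x : R) :
  (\forall y \near x, x < y -> P y) -> \forall y \near x^'+, P y.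
Proof. by []. Qed.

Lemma cvg_near_eq (F : set_system R) {FF : Filter F} (g k : R -> R) (l : R) :
  (\forall x \near F, g x = k x) -> k @ F --> l -> g @ F --> l.
Proof.
move=> E; apply: cvg_trans; apply: near_eq_cvg; apply: filterS E => x; exact: esym.
Qed.

Lemma cvgC_near_eq (F : set_system R) {FF : Filter F} (g k : R -> C) (l : C) :
  (\forall x \near F, g x = k x) -> cvgC F k l -> cvgC F g l.
Proof.
move=> E [h1 h2]; split; [apply: cvg_near_eq h1|apply: cvg_near_eq h2];
  by apply: filterS E => x; rewrite /re /im => ->.
Qed.

Lemma cvgC_unique (F : set_system R) {FF : ProperFilter F} (g : R -> C) (l m : C) :
  cvgC F g l -> cvgC F g m -> l = m.
Proof.
move=> [h1 h2] [h3 h4]; apply/eqP; rewrite eq_complex; apply/andP; split; apply/eqP.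
  exact: (cvg_unique (@norm_hausdorff _ R^o) h1 h3).
exact: (cvg_unique (@norm_hausdorff _ R^o) h2 h4).
Qed.

Lemma cexpcomb_cvg_left A B (x : R) : cvgC x^'- (cexpcomb A B) (cexpcomb A B x).
Proof.
by have [h1 h2] := continuousC_cexpcomb A B; split; apply: cvg_at_left_filter;
  [exact: h1|exact: h2].
Qed.

Lemma cexpcomb_cvg_right A B (x : R) : cvgC x^'+ (cexpcomb A B) (cexpcomb A B x).
Proof.
by have [h1 h2] := continuousC_cexpcomb A B; split; apply: cvg_at_right_filter;
  [exact: h1|exact: h2].
Qed.

Lemma piecewise_sol_cvg z s u (x : R) : sorted <%R (map (@pos R) s) ->
  cvgC x^'- (piecewise_sol z s u) (piecewise_sol z s u x) /\ cvgC x^'+ (piecewise_sol z s u) (piecewise_sol z s u x).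
Proof.
move=> ss; split.
  rewrite {2}/piecewise_sol -piecewise_sol_match //; set w := ctransfer _ _ _.
  apply: (fun E => cvgC_near_eq E (cexpcomb_cvg_left w.1 w.2 x)).
  by apply/near_left; apply: filterS (piecewise_sol_near z s u x) => y [_ h] /h.
set v := ctransfer z [seq t <- s | x < pos t] u.
apply: (fun E => cvgC_near_eq E (cexpcomb_cvg_right v.1 v.2 x)).
by apply/near_right; apply: filterS (piecewise_sol_near z s u x) => y [h _] /ltW /h.
Qed.

Lemma piecewise_sol_continuousC z s u : sorted <%R (map (@pos R) s) ->
  continuousC (piecewise_sol z s u).
Proof.
move=> ss; split=> x; apply/left_right_continuousP; have [[h1 h2] [h3 h4]] :=
  piecewise_sol_cvg z u x ss.
  by split.
by split.
Qed.
End Piecewise.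

Section Solutions.
Local Open Scope classical_set_scope.
Local Open Scope ring_scope.
Variable R : realType.
Notation C := (R[i]).
Implicit Types (t : R * R * R) (s : seq (R * R * R)) (u v w : C * C).

(** The hypothesis is about one side only, so the derivative is computed at nearby
points of that side. *)
Lemma deriveC_left (f : R -> C) A B (x : R) :
  (\forall y \near x, y < x -> f y = cexpcomb A B y) -> cvgC x^'- (deriveC f) (dcexpcomb A B x).
Proof.
move=> /near_join H; apply: cvgC_near_eq (cexpcomb_cvg_left _ _ x); apply/near_left.
near=> y => yx; rewrite -[RHS]/(dcexpcomb A B y) -deriveC_cexpcomb; apply: deriveC_near.
have H2 : \forall y' \near y, y' < x -> f y' = cexpcomb A B y' by near: y.
near=> y'; have : y' < x by near: y'; exact: lt_nbhsl.
by near: y'.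
Unshelve. all: by end_near. Qed.

Lemma deriveC_right (f : R -> C) A B (x : R) :
  (\forall y \near x, x < y -> f y = cexpcomb A B y) -> cvgC x^'+ (deriveC f) (dcexpcomb A B x).
Proof.
move=> /near_join H; apply: cvgC_near_eq (cexpcomb_cvg_right _ _ x); apply/near_right.
near=> y => yx; rewrite -[RHS]/(dcexpcomb A B y) -deriveC_cexpcomb; apply: deriveC_near.
have H2 : \forall y' \near y, x < y' -> f y' = cexpcomb A B y' by near: y.
near=> y'; have : x < y' by near: y'; exact: lt_nbhsr.
by near: y'.
Unshelve. all: by end_near. Qed.

Lemma sorted_atoms (p : mpair R) : sorted <%R (map (@pos R) (atoms p)).
Proof. by case: p => s /= /and4P[]. Qed.

Lemma valid_atoms (p : mpair R) : all (@valid_weights R) (atoms p).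
Proof.
case: p => s /= /and4P[_ _ /allP h1 /allP h2].
by apply/allP => t ts; rewrite /valid_weights h1 // h2.
Qed.

Lemma piecewise_sol_solution (p : mpair R) z u : is_solution p z (piecewise_sol z (atoms p) u).
Proof.
have ss := sorted_atoms p; split; first exact: piecewise_sol_continuousC.
  move=> x xs; pose v := ctransfer z [seq t <- atoms p | x < pos t] u.
  apply: (@ode_near _ _ v.1 v.2).
  apply: filterS (piecewise_sol_near z (atoms p) u x) => y; rewrite filter_not_atom // =>
    -[h1 h2].
  by case: (leP x y) => [/h1|/h2].
move=> t ts; set x := pos t.
pose v := ctransfer z [seq t <- atoms p | x < pos t] u.
pose w := ctransfer z [seq t <- atoms p | x <= pos t] u.
exists (dcexpcomb w.1 w.2 x), (dcexpcomb v.1 v.2 x); split.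
- apply: deriveC_left; apply: filterS (piecewise_sol_near z (atoms p) u x) => y [_ h] /h; exact.
- apply: deriveC_right; apply: filterS (piecewise_sol_near z (atoms p) u x) => y [h _] /ltW /h;
  exact.
have : w = atom_step (real_complex R) z t v by rewrite /w filter_atom.
by move/step_cexpcomb => [_ ->]; rewrite mulrDl addrA.
Qed.

Lemma near_all_lt s (x : R) : all (fun t => pos t < x) s ->
  \forall y \near x, all (fun t => pos t < y) s.
Proof.
elim: s => [_|t s IH /= /andP[tx /IH H]]; first by near=> y.
by near=> y; apply/andP; split; near: y => //; exact: lt_nbhsr.
Unshelve. all: by end_near. Qed.

Lemma near_all_gt s (x : R) : all (fun t => x < pos t) s ->
  \forall y \near x, all (fun t => y < pos t) s.
Proof.
elim: s => [_|t s IH /= /andP[tx /IH H]]; first by near=> y.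
by near=> y; apply/andP; split; near: y => //; exact: lt_nbhsl.
Unshelve. all: by end_near. Qed.

Lemma all_lt_trans s (x y : R) : x <= y -> all (fun t => pos t < x) s -> all (fun t =>
  pos t < y) s.
Proof. by move=> xy; apply: sub_all => t h; exact: lt_le_trans xy. Qed.

Lemma all_gt_trans s (x y : R) : y <= x -> all (fun t => x < pos t) s -> all (fun t =>
  y < pos t) s.
Proof. by move=> xy; apply: sub_all => t; exact: le_lt_trans. Qed.

Lemma filter_all_gt s (x : R) : all (fun t => x < pos t) s -> [seq t <- s | x < pos t] = s.
Proof. by move/all_filterP. Qed.

Lemma notin_pos s (x : R) : ~~ has (fun t => pos t == x) s -> x \notin map (@pos R) s.
Proof. by apply: contra => /mapP[t ts ->]; apply/hasP; exists t. Qed.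

Lemma sorted_split s1 t s2 : sorted <%R (map (@pos R) (s1 ++ t :: s2)) ->
  all (fun r => pos r < pos t) s1 /\ all (fun r => pos t < pos r) s2.
Proof.
rewrite map_cat /=.
rewrite (sorted_pairwise lt_trans) pairwise_cat allrel_consr /= =>
  /and3P[/andP[h1 _] _ /andP[h2 _]].
by rewrite all_map in h1; rewrite all_map in h2.
Qed.

(** Atoms are crossed from right to left: the form of the solution on the next
interval is [ode_on], and the one-sided limits at the atom identify its
coefficients through [step_cexpcomb]. *)
Lemma solution_piecewise_sol (p : mpair R) z f : is_solution p z f ->
  exists u, forall x, f x = piecewise_sol z (atoms p) u x.
Proof.
move=> [[cre cim] ode jmp]; have ss := sorted_atoms p.
suff H s2 s1 : atoms p = s1 ++ s2 -> exists u, forall x,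
    all (fun t => pos t < x) s1 -> f x = piecewise_sol z s2 u x.
  by have [u H'] := H (atoms p) [::] erefl; exists u => x; exact: H'.
elim: s2 s1 => [|t s2 IH] s1 E.
  pose D x := all (fun t => pos t < x) s1 : Prop.
  have [||A [B HAB]] := @ode_on R D f.
  - by move=> x y w Dx _ /andP[/ltW xw _]; exact: all_lt_trans xw Dx.
  - move=> x Dx; apply: ode; rewrite E cats0; apply: notin_pos.
    by apply/hasPn => r /(allP Dx) h; rewrite lt_eqF.
  by exists (A, B) => x /HAB[].
have [u Hu] := IH (rcons s1 t) (etrans E (esym (cat_rcons _ _ _))).
have [lt1 gt2] : all (fun r => pos r < pos t) s1 /\ all (fun r => pos t < pos r) s2.
  by apply: sorted_split; rewrite -E.
set x := pos t in lt1 gt2.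
pose v := ctransfer z s2 u.
pose D y := all (fun r => pos r < y) s1 /\ y < x.
have [||A [B HAB]] := @ode_on R D f.
- move=> y y' w [Dy _] [_ y'x] /andP[/ltW yw wy']; split; last exact: lt_trans wy' y'x.
  exact: all_lt_trans yw Dy.
- move=> y [Dy yx]; apply: ode; rewrite E; apply: notin_pos; rewrite has_cat /= !negb_or.
  apply/and3P; split.
  + by apply/hasPn => r /(allP Dy) h; rewrite lt_eqF.
  + by rewrite gt_eqF.
  + by apply/hasPn => r /(allP gt2) h; rewrite gt_eqF // (lt_trans yx).
have nearL : \forall y \near x, y < x -> f y = cexpcomb A B y.
  by apply: filterS (near_all_lt lt1) => y h yx; have [] := HAB y (conj h yx).
have nearR : \forall y \near x, x < y -> f y = cexpcomb v.1 v.2 y.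
  apply: filterS (near_all_gt gt2) => y h xy.
  rewrite Hu ?all_rcons ?xy ?(all_lt_trans (ltW xy)) //=.
  by rewrite /piecewise_sol filter_all_gt.
have fxL : f x = cexpcomb A B x.
  have h1 : cvgC x^'- f (f x).
    by split; apply: cvg_at_left_filter; [exact: cre|exact: cim].
  apply: cvgC_unique h1 _; apply: cvgC_near_eq (cexpcomb_cvg_left _ _ x); exact/near_left.
have fxR : f x = cexpcomb v.1 v.2 x.
  have h1 : cvgC x^'+ f (f x).
    by split; apply: cvg_at_right_filter; [exact: cre|exact: cim].
  apply: cvgC_unique h1 _; apply: cvgC_near_eq (cexpcomb_cvg_right _ _ x); exact/near_right.
have tp : t \in atoms p by rewrite E mem_cat inE eqxx orbT.
have [l [r [Hl Hr Elr]]] := jmp t tp.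
have lE := cvgC_unique Hl (deriveC_left nearL).
have rE := cvgC_unique Hr (deriveC_right nearR).
have AB : (A, B) = atom_step (real_complex R) z t v.
  apply/step_cexpcomb; rewrite /= -/x -fxL -fxR; split=> //.
  by rewrite -lE -rE Elr mulrDl addrA.
exists u => y Dy; rewrite /piecewise_sol /=; case: (ltgtP y (pos t)) => [yx|xy|yx].
- have gt2' : all (fun r => y < pos r) s2 by exact: all_gt_trans (ltW yx) gt2.
  have -> : ctransfer z (t :: [seq r <- s2 | y < pos r]) u = (A,
    B) by rewrite filter_all_gt // AB.
  by have [] := HAB y (conj Dy yx).
- by rewrite Hu // all_rcons xy.
- by rewrite yx -/x filter_all_gt // fxR.
Qed.
End Solutions.

(** * Eigenvalues *)

Section Spectrum.
Local Open Scope classical_set_scope.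
Local Open Scope ring_scope.
Variable R : realType.
Notation C := (R[i]).
Notation rc := (real_complex R).
Implicit Types (t : R * R * R) (s : seq (R * R * R)) (u v w : C * C).

Lemma exists_gt s : exists b : R, all (fun t => pos t < b) s.
Proof.
elim: s => [|t s [b IH]]; first by exists 0.
exists (Num.max (pos t + 1) b) => /=; rewrite lt_max ltrDl ltr01 /=.
by apply: all_lt_trans IH; rewrite le_max lexx orbT.
Qed.

Lemma exists_lt s : exists b : R, all (fun t => b < pos t) s.
Proof.
elim: s => [|t s [b IH]]; first by exists 0.
exists (Num.min (pos t - 1) b) => /=; rewrite gt_min gtrBl ltr01 /=.
by apply: all_gt_trans IH; rewrite ge_min lexx orbT.
Qed.

Lemma piecewise_sol_right z s u (x : R) : all (fun t => pos t <= x) s ->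
  piecewise_sol z s u x = cexpcomb u.1 u.2 x.
Proof.
move=> h; rewrite /piecewise_sol (_ : [seq t <- s | x < pos t] = [::]) //.
by apply/eqP; rewrite -(negbK (_ == _)) -has_filter; apply/hasPn => t /(allP h); rewrite -leNgt.
Qed.

Lemma piecewise_sol_left z s u (x : R) : all (fun t => x < pos t) s ->
  piecewise_sol z s u x = cexpcomb (ctransfer z s u).1 (ctransfer z s u).2 x.
Proof. by move=> h; rewrite /piecewise_sol filter_all_gt. Qed.

(** After multiplication by e^(x/2) the real and imaginary parts become
a e^x + b, which has at most one zero unless a = b = 0. *)
Lemma cexpcomb_eq0 A B (x y : R) : x < y -> cexpcomb A B x = 0 -> cexpcomb A B y = 0 ->
  A = 0 /\ B = 0.
Proof.
have key (a b : R) : x < y -> expcomb a b x = 0 -> expcomb a b y = 0 -> a = 0 /\ b = 0.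
  move=> xy h1 h2.
  have m (q : R) : expcomb a b q = 0 -> a * expR q + b = 0.
    move=> h; have : expR (2^-1 * q) * expcomb a b q = 0 by rewrite h mulr0.
    rewrite /expcomb mulrDr mulrCA -expRD mulrCA -expRD -mulrDl mulNr subrr expR0 mulr1.
    by rewrite (_ : 2^-1 + 2^-1 = 1 :> R) ?mul1r //; lra.
  move/m: h1 => h1; move/m: h2 => h2.
  have a0 : a = 0.
    have : a * (expR y - expR x) = 0.
      by rewrite mulrBr -(addrK b (a * expR y)) h2 -(addrK b (a * expR x)) h1 subrr.
    by move/eqP; rewrite mulf_eq0 subr_eq0 [X in _ || X]gt_eqF ?ltr_expR // orbF => /eqP.
  by split=> //; rewrite a0 mul0r add0r in h1.
move=> xy h1 h2.
have [r1 r2] : complex.Re A = 0 /\ complex.Re B = 0.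
  by apply: key => //; rewrite -re_cexpcomb /re ?h1 ?h2.
have [i1 i2] : complex.Im A = 0 /\ complex.Im B = 0.
  by apply: key => //; rewrite -im_cexpcomb /im ?h1 ?h2.
by move: r1 r2 i1 i2; case: A B {h1 h2} => [a a'] [b b'] /= -> -> -> ->.
Qed.

Lemma cexpcombB A B A' B' (x : R) : cexpcomb A B x - cexpcomb A' B' x =
  cexpcomb (A - A') (B - B') x.
Proof. by rewrite /cexpcomb; ring. Qed.

Lemma piecewise_sol_phi_plus (p : mpair R) z : is_phi_plus p z (piecewise_sol z (atoms p) (0, 1)).
Proof.
split; first exact: piecewise_sol_solution.
have [b Hb] := exists_gt (atoms p).
near=> x; rewrite piecewise_sol_right /=; last first.
  apply: sub_all Hb => t /ltW h; apply: le_trans h _; apply: ltW; near: x.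
  exact: (nbhs_pinfty_gt (num_real _)).
by rewrite /cexpcomb mul0r add0r mul1r mulNr mulrC mulNr.
Unshelve. all: by end_near. Qed.

Lemma phi_plus_unique (p : mpair R) z phi : is_phi_plus p z phi ->
  phi = piecewise_sol z (atoms p) (0, 1).
Proof.
move=> [sol nr]; have [u Hu] := solution_piecewise_sol sol.
have [_ nr'] := piecewise_sol_phi_plus p z.
suff -> : (0, 1) = u by apply/funext.
have [b Hb] := exists_gt (atoms p).
have [[M [Mr HM]] [M' [Mr' HM']]] := (nr, nr').
pose x := Num.max (Num.max M M' + 1) b.
have E y : x <= y -> cexpcomb (0 - u.1) (1 - u.2) y = 0.
  move=> xy.
  have Hy : all (fun t => pos t <= y) (atoms p).
    apply: sub_all Hb => t /ltW h; apply: le_trans h _; apply: le_trans xy.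
    by rewrite /x le_max lexx orbT.
  have My : Num.max M M' < y.
    by apply: lt_le_trans xy; rewrite /x lt_max ltrDl ltr01.
  move: My; rewrite gt_max => /andP[/HM h1 /HM' h2].
  move: h1 h2; rewrite Hu !piecewise_sol_right // => h1 h2.
  by rewrite -cexpcombB /= h2 h1 subrr.
have [] := cexpcomb_eq0 (_ : x < x + 1) (E _ (lexx _)) (E (x + 1) _).
- by rewrite ltrDl.
- by rewrite lerDl.
by case: u {Hu E} => u1 u2 /= /eqP; rewrite sub0r oppr_eq0 => /eqP -> /eqP; rewrite subr_eq0 =>
  /eqP <-.
Qed.

Lemma expcomb_bounded (al be M x0 : R) : (forall x, x0 < x -> `|expcomb al be x| <= M) -> al = 0.
Proof.
move=> H; apply/eqP/negPn/negP => al0.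
have al1 : 0 < `|al| by rewrite normr_gt0.
pose y := (M + `|be|) / `|al|.
(* at x the growing term exceeds M + |be| *)
pose x := Num.max (Num.max (x0 + 1) 0) (2 * y).
have x0x : x0 < x by rewrite /x lt_max lt_max ltrDl ltr01.
have x_ge0 : 0 <= x by rewrite /x le_max le_max lexx orbT.
have yx : 2 * y <= x by rewrite /x le_max lexx orbT.
have := H x x0x; apply/negP; rewrite -ltNge.
have e1 : y < expR (2^-1 * x).
  apply: lt_le_trans (expR_ge1Dx _); lra.
have e2 : expR (- 2^-1 * x) <= 1.
  by rewrite -[leRHS]expR0 ler_expR; lra.
have e3 := expR_gt0 (- 2^-1 * x); have e4 := expR_gt0 (2^-1 * x).
have h1 : M + `|be| < `|al * expR (2^-1 * x)|.
  by rewrite normrM (gtr0_norm e4) mulrC -ltr_pdivrMr.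
have h2 : `|be * expR (- 2^-1 * x)| <= `|be|.
  by rewrite normrM (gtr0_norm e3) ler_piMr.
have := lerB_normD (al * expR (2^-1 * x)) (be * expR (- 2^-1 * x)).
rewrite /expcomb; lra.
Qed.

Lemma norm_re_le (c : C) : `|complex.Re c| <= normc c.
Proof.
case: c => a b /=; rewrite -sqrtr_sqr ler_wsqrtr //.
by rewrite lerDl sqr_ge0.
Qed.

Lemma norm_im_le (c : C) : `|complex.Im c| <= normc c.
Proof.
case: c => a b /=; rewrite -sqrtr_sqr ler_wsqrtr //.
by rewrite lerDr sqr_ge0.
Qed.

Lemma cexpcomb_bounded_right A B (M x0 : R) : (forall x, x0 < x ->
  normc (cexpcomb A B x) <= M) -> A = 0.
Proof.
move=> H; apply/eqP; rewrite eq_complex; apply/andP; split; apply/eqP.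
  apply: (@expcomb_bounded _ (complex.Re B) M x0) => x /H; apply: le_trans.
  by rewrite -re_cexpcomb; exact: norm_re_le.
apply: (@expcomb_bounded _ (complex.Im B) M x0) => x /H; apply: le_trans.
by rewrite -im_cexpcomb; exact: norm_im_le.
Qed.

Lemma cexpcombN A B (x : R) : cexpcomb A B (- x) = cexpcomb B A x.
Proof. by rewrite /cexpcomb !mulrN !mulNr opprK addrC. Qed.

Lemma cexpcomb_bounded_left A B (M x0 : R) : (forall x, x < x0 ->
  normc (cexpcomb A B x) <= M) -> B = 0.
Proof.
move=> H; apply: (@cexpcomb_bounded_right B A M (- x0)) => x xx0.
by rewrite -cexpcombN; apply: H; rewrite ltrNl.
Qed.
End Spectrum.

Section Eigen.
Local Open Scope classical_set_scope.
Local Open Scope ring_scope.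
Variable R : realType.
Notation C := (R[i]).
Notation rc := (real_complex R).
Implicit Types (t : R * R * R) (s : seq (R * R * R)) (u v w : C * C).

Lemma le_normcD (x y : C) : normc (x + y) <= normc x + normc y.
Proof.
have : `|x + y| <= `|x| + `|y| by exact: ler_normD.
by rewrite -[`|x|]/((normc x)%:C) -[`|y|]/((normc y)%:C) -[`|_|]/((normc (x +
  y))%:C) -rmorphD lecR.
Qed.

Lemma normc_ge0 (x : C) : 0 <= normc x.
Proof. by case: x => a b; exact: sqrtr_ge0. Qed.

Lemma normc_cexpcomb A B (x : R) :
  normc (cexpcomb A B x) <= normc A * expR (2^-1 * x) + normc B * expR (- 2^-1 * x).
Proof.
apply: le_trans (le_normcD _ _) _.
have nr (r : R) : 0 < r -> normc r%:C = r.
  by move=> r0; rewrite /= expr0n addr0 sqrtr_sqr gtr0_norm.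
by rewrite !ComplexField.Normc.normcM !nr ?expR_gt0.
Qed.

Lemma continuousC_bounded (f : R -> C) (a b : R) : continuousC f ->
  exists M, forall x, a <= x <= b -> normc (f x) <= M.
Proof.
move=> [c1 c2]; have [ab|ba] := leP a b; last first.
  by exists 0 => x /andP[h1 h2]; have := le_lt_trans (le_trans h1 h2) ba; rewrite ltxx.
have cg : {within `[a, b], continuous (fun x => re f x * re f x + im f x * im f x : R^o)}.
  by apply: continuous_subspaceT => x; apply: cvgD; apply: cvgM; (exact: c1 || exact: c2).
have [c _ H] := EVT_max ab cg.
exists (Num.sqrt (re f c * re f c + im f c * im f c)) => x xab.
have := H x; rewrite in_itv /= => /(_ xab); rewrite /re /im.
by case: (f x) => p q /= h; rewrite ler_wsqrtr // !expr2.
Qed.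

(** Boundedness at +oo and -oo excludes e^(x/2) and e^(-x/2) respectively, so a
bounded solution is a multiple of phi_+ whose coefficient of e^(-x/2) vanishes to
the left of all atoms. *)
Lemma eigenvalue_iff (p : mpair R) (z : C) :
  is_eigenvalue p z <-> (ctransfer z (atoms p) (0, 1)).2 = 0.
Proof.
have [b Hb] := exists_gt (atoms p); have [a Ha] := exists_lt (atoms p).
have Hb' x : b < x -> all (fun t => pos t <= x) (atoms p).
  by move=> bx; apply: sub_all Hb => t /ltW h; apply: le_trans h (ltW bx).
have Ha' x : x < a -> all (fun t => x < pos t) (atoms p).
  by move=> xa; apply: all_gt_trans (ltW xa) Ha.
split=> [[f [sol [x0 fx0] [M HM]]]|W0].
  have [u Hu] := solution_piecewise_sol sol.
  have u10 : u.1 = 0.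
    apply: (@cexpcomb_bounded_right R u.1 u.2 M b) => x bx.
    by rewrite -(@piecewise_sol_right _ z (atoms p)) ?Hb' // -Hu.
  have w20 : (ctransfer z (atoms p) u).2 = 0.
    apply: (@cexpcomb_bounded_left R (ctransfer z (atoms p) u).1 _ M a) => x xa.
    by rewrite -piecewise_sol_left ?Ha' // -Hu.
  have uE : u = (u.2 * 0 + 0 * 1, u.2 * 1 + 0 * 0).
    by case: u u10 {Hu w20} => u1 u2 /= ->; rewrite !mulr0 !mulr1 !addr0.
  have u20 : u.2 != 0.
    apply: contra fx0 => /eqP u20; have u00 : u = (0, 0).
      by rewrite [u]surjective_pairing u10 u20.
    rewrite Hu /piecewise_sol u00.
    by rewrite /ctransfer transfer0 /cexpcomb /= !mul0r addr0.
  move: w20; rewrite uE /ctransfer (@transfer_lin _ _ _ _ _ _ _ (0, 1) (1, 0)) /= mul0r addr0.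
  by move/eqP; rewrite mulf_eq0 (negbTE u20) => /eqP.
exists (piecewise_sol z (atoms p) (0, 1)); split; first exact: piecewise_sol_solution.
  exists (b + 1); rewrite piecewise_sol_right ?Hb' ?ltrDl // /cexpcomb /= mul0r add0r mul1r.
  by rewrite fmorph_eq0 gt_eqF // expR_gt0.
have [M HM] := continuousC_bounded a b (piecewise_sol_continuousC z (0, 1) (sorted_atoms p)).
set w := ctransfer z (atoms p) (0, 1) in W0.
exists (Num.max M (Num.max (expR (- 2^-1 * b)) (normc w.1 * expR (2^-1 * a)))) => x.
rewrite !le_max; have [ax|xa] := leP a x; last first.
  apply/orP; right; apply/orP; right; rewrite piecewise_sol_left ?Ha' // -/w.
  apply: le_trans (normc_cexpcomb _ _ _) _; rewrite W0 ComplexField.Normc.normc0 mul0r addr0.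
  apply: ler_wpM2l; first exact: normc_ge0.
  by rewrite ler_expR; lra.
have [xb|bx] := leP x b; first by rewrite HM // ax.
apply/orP; right; apply/orP; left; rewrite piecewise_sol_right ?Hb' //.
apply: le_trans (normc_cexpcomb 0 1 x) _; rewrite ComplexField.Normc.normc0 mul0r add0r.
rewrite ComplexField.Normc.normc1 mul1r ler_expR; lra.
Qed.

Definition ceval (z : C) (q : {poly R}) : C := (map_poly rc q).[z].

Lemma cevalE (x : R) (q : {poly R}) : ceval x%:C q = (q.[x])%:C.
Proof. by rewrite /ceval horner_map. Qed.

Lemma ctransfer_ceval z s :
  ctransfer z s (0, 1) = (ceval z (poly_state s).1, ceval z (poly_state s).2).
Proof.
elim: s => [|t s IH]; first by rewrite /ctransfer /poly_state /ceval /= rmorph0 rmorph1 !hornerE.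
rewrite /ctransfer /= -/(ctransfer z s (0, 1)) IH /poly_state /= -/(poly_state s).
move: (poly_state s) => [P Q]; rewrite /atom_step /jump /ceval /=.
rewrite !(rmorphD, rmorphN, rmorphM) /= !map_polyX !map_polyC /=.
by rewrite !(hornerD, hornerN, hornerM, hornerC, hornerX) !expr2.
Qed.

Lemma eigenvalue_root (p : mpair R) (z : C) :
  is_eigenvalue p z <-> ceval z (poly_state (atoms p)).2 = 0.
Proof. by rewrite eigenvalue_iff ctransfer_ceval. Qed.

Lemma phi_plus_real (p : mpair R) (lam x : R) :
  piecewise_sol lam%:C (atoms p) (0, 1) x =
  (expR (- x / 2%:R) * (phi_poly x [seq t <- atoms p | x < pos t]).[lam])%:C.
Proof.
rewrite /piecewise_sol ctransfer_ceval /= !cevalE /cexpcomb -!rmorphM -rmorphD /=; congr (_%:C).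
rewrite /phi_poly /grow_poly hornerD hornerM hornerC;
  move: (poly_state _).1.[lam] (poly_state _).2.[lam] => P Q.
rewrite mulrDr mulrA -expRD addrC mulrC (_ : - x / 2 = - 2^-1 * x); last by lra.
by rewrite (_ : - 2^-1 * x + x = 2^-1 * x) ?[_ * P]mulrC //; lra.
Qed.

Lemma gamma_poly_sum s (lam : R) : sorted <%R (map (@pos R) s) ->
  (gamma_poly s).[lam] = \sum_(t <- s) (womega t + 2 * lam * wv t) *
     (expR (- pos t) * (phi_poly (pos t) [seq r <- s | pos t < pos r]).[lam] ^+ 2).
Proof.
elim: s => [|t s IH]; first by rewrite big_nil /= horner0.
move=> ss; have ss' : sorted <%R (map (@pos R) s) by exact: path_sorted ss.
rewrite big_cons /= ltxx hornerD IH // addrC; congr (_ + _); last first.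
  apply: eq_big_seq => r rs; rewrite lt_gtF //.
  have := ss; rewrite /= (path_sortedE lt_trans) => /andP[/allP ls _].
  exact/ls/map_f.
rewrite hornerM hornerD hornerC !hornerZ hornerX horner_exp; congr (_ * (_ * _ ^+ 2)).
  by rewrite mulrAC.
rewrite (_ : [seq r <- s | pos t < pos r] = s) //.
apply/all_filterP/allP => r rs.
have := ss; rewrite /= (path_sortedE lt_trans) => /andP[/allP ls _].
exact/ls/map_f.
Qed.

Lemma gamma_sq_phi (p : mpair R) (lam : R) :
  gamma_sq p lam (piecewise_sol lam%:C (atoms p) (0, 1)) = (gamma_poly (atoms p)).[lam].
Proof.
rewrite gamma_poly_sum ?sorted_atoms // /gamma_sq /int_omega /int_v mulr_sumr -big_split /=.
apply: eq_bigr => t _; rewrite phi_plus_real.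
set K := (phi_poly _ _).[_].
have -> : normc (expR (- pos t / 2%:R) * K)%:C ^+ 2 = expR (- pos t) * K ^+ 2.
  rewrite /= expr0n addr0 sqrtr_sqr real_normK ?num_real // exprMn; congr (_ * _).
  by rewrite expr2 -expRD -splitr.
ring.
Qed.
End Eigen.

(** * Splitting a pair at a point *)

Section SplitAt.
Variable R : realType.
Implicit Types (t : R * R * R) (s : seq (R * R * R)) (a : R).

Definition left_part a s := [seq t <- s | pos t < a].
Definition mid_part a s := [seq t <- s | pos t == a].
Definition right_part a s := [seq t <- s | a < pos t].

Definition phi_right a s := phi_poly a (right_part a s).
Definition grow_right a s := grow_poly a (right_part a s).
Definition phi_left a s := phi_poly (- a) (reflects (left_part a s)).
Definition grow_left a s := grow_poly (- a) (reflects (left_part a s)).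
Definition jump_at a s := total_jump (mid_part a s).

Lemma split_parts a s : sorted <%R (map (@pos R) s) ->
  s = left_part a s ++ mid_part a s ++ right_part a s.
Proof.
elim: s => //= t s IH ss.
have {}IH := IH (path_sorted ss).
have gt r : r \in s -> pos t < pos r.
  move=> rs; have := ss; rewrite (path_sortedE lt_trans) => /andP[/allP ls _].
  exact/ls/map_f.
have right_all : a <= pos t -> [/\ left_part a s = [::], mid_part a s = [::] & right_part a s =
  s].
  move=> h; split.
  - by apply/eqP; rewrite -(negbK (_ == _)) -has_filter; apply/hasPn => r /gt h';
       rewrite -leNgt (le_trans h) // ltW.
  - by apply/eqP; rewrite -(negbK (_ == _)) -has_filter; apply/hasPn => r /gt h';
       rewrite gt_eqF // (le_lt_trans h).
  - by apply/all_filterP/allP => r /gt; exact: le_lt_trans.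
case: (ltgtP (pos t) a) => [ta|at_|ta] /=; first by rewrite -IH.
  by have [-> -> ->] := right_all (ltW at_).
by have [] := right_all; [rewrite ta | move=> -> -> ->].
Qed.

Lemma size_mid_part a s : sorted <%R (map (@pos R) s) -> (size (mid_part a s) <= 1)%N.
Proof.
move=> ss; have : sorted <%R (map (@pos R) (mid_part a s)).
  apply: (subseq_sorted lt_trans _ ss); apply: map_subseq; exact: filter_subseq.
have : all (fun t => pos t == a) (mid_part a s) by exact: filter_all.
case: (mid_part a s) => [|t [|t' m]] //= /and3P[/eqP -> /eqP -> _].
by rewrite ltxx.
Qed.

Lemma all_mid_part a s : all (fun t => pos t == a) (mid_part a s).
Proof. exact: filter_all. Qed.

Lemma path_right_part a s : sorted <%R (map (@pos R) s) ->
  path <%R a (map (@pos R) (right_part a s)).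
Proof.
move=> ss; rewrite (path_sortedE lt_trans); apply/andP; split.
  by rewrite all_map; exact: filter_all.
apply: (subseq_sorted lt_trans _ ss); apply: map_subseq; exact: filter_subseq.
Qed.

Lemma map_pos_reflects s : map (@pos R) (reflects s) = rev (map -%R (map (@pos R) s)).
Proof. by rewrite /reflects map_rev -!map_comp. Qed.

Lemma path_reflects a s : all (fun t => pos t < a) s -> sorted <%R (map (@pos R) s) ->
  path <%R (- a) (map (@pos R) (reflects s)).
Proof.
move=> sa ss; rewrite (path_sortedE lt_trans) map_pos_reflects; apply/andP; split.
  rewrite all_rev !all_map; apply: sub_all sa => t /=; by rewrite ltrN2.
rewrite rev_sorted sorted_map; apply: sub_sorted ss => x y /=; by rewrite ltrN2.
Qed.

Lemma path_left_part a s : sorted <%R (map (@pos R) s) ->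
  path <%R (- a) (map (@pos R) (reflects (left_part a s))).
Proof.
move=> ss; apply: path_reflects; first exact: filter_all.
apply: (subseq_sorted lt_trans _ ss); apply: map_subseq; exact: filter_subseq.
Qed.

Lemma valid_reflects s : all (@valid_weights R) s -> all (@valid_weights R) (reflects s).
Proof. by rewrite /reflects all_rev all_map; apply: sub_all => -[[x o] w]. Qed.

Lemma valid_filter (P : pred (R * R * R)) s : all (@valid_weights R) s ->
  all (@valid_weights R) [seq t <- s | P t].
Proof. by move=> h; rewrite all_filter; apply: sub_all h => t vt; apply/implyP. Qed.

Lemma wronskian_at a s : sorted <%R (map (@pos R) s) ->
  (poly_state s).2 = phi_right a s * phi_left a s - phi_right a s * grow_left a s
     - grow_right a s * phi_left a s - jump_at a s * phi_right a s * phi_left a s.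
Proof.
move=> ss; rewrite {1}(split_parts a ss).
exact: (wronskian_split (left_part a s) (right_part a s) (size_mid_part a ss) (all_mid_part a s)).
Qed.

Lemma phi_at_eigenvalue_poly a s : sorted <%R (map (@pos R) s) -> exists q : {poly R},
  phi_right a s = expR a *: ((poly_state s).1 * phi_left a s) + (poly_state s).2 * q.
Proof.
move=> ss.
have [q] := phi_split (left_part a s) (right_part a s) (size_mid_part a ss) (all_mid_part a s).
by rewrite -split_parts // => E; exists q.
Qed.

Lemma jump_at_size a s : sorted <%R (map (@pos R) s) -> all (@valid_weights R) s ->
  jump_at a s = 0 \/ (1 < size (jump_at a s))%N.
Proof.
move=> ss vs; rewrite /jump_at /total_jump.
have := size_mid_part a ss; have := valid_filter (fun t => pos t == a) vs.
rewrite -/(mid_part a s).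
case: (mid_part a s) => [|t [|]] //=; first by rewrite big_nil; left.
by rewrite andbT big_seq1 => /size_poly_jump h _; right.
Qed.

(** By [wronskian_at], W / (phi_+ phi_-) is 1 minus two quotients with nonpositive
limits at z = oo, minus the jump at [a]. It therefore does not tend to 0. *)
Lemma size_wronskian a s : sorted <%R (map (@pos R) s) -> all (@valid_weights R) s ->
  (size (phi_right a s * phi_left a s)%R <= size (poly_state s).2)%N.
Proof.
move=> ss vs; rewrite (wronskian_at a ss).
have [_ [cp cp0 Hp]] := phi_grow_size (path_right_part a ss) (valid_filter _ vs).
have [_ [cm cm0 Hm]] := phi_grow_size (path_left_part a ss) (valid_reflects (valid_filter _ vs)).
rewrite -/(phi_right a s) -/(grow_right a s) in Hp;
  rewrite -/(phi_left a s) -/(grow_left a s) in Hm.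
have Kp0 : phi_right a s != 0 by exact: phi_poly_neq0.
have Km0 : phi_left a s != 0 by exact: phi_poly_neq0.
have hs := jump_at_size a ss vs.
move: (phi_right a s) (grow_right a s) (phi_left a s) (grow_left a s) (jump_at a s) Hp Hm Kp0 Km0 hs.
move=> K V K' V' h Hp Hm K0 K'0 hs.
(* after adding suitable multiples of K and K' to V and V', only the first term
   has the full degree *)
have -> : K * K' - K * V' - V * K' - h * K * K' =
  ((1 + cp + cm)%:P - h) * (K * K') - (K * (V' + cm *: K') + (V + cp *: K) * K').
  by rewrite -!mul_polyC !polyCD polyC1; ring.
have lt : (size (K * (V' + cm *: K') + (V + cp *: K) * K')%R < size (K * K')%R)%N.
  have mono (P P1 Q : {poly R}) : Q != 0 -> (size P < size P1)%N ->
      (size (P * Q)%R < size (P1 * Q)%R)%N.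
    move=> Q0 PP; have P10 : P1 != 0 by apply/eqP => z; rewrite z size_poly0 in PP.
    have [->|P0] := eqVneq P 0; first by rewrite mul0r size_poly0 lt0n size_poly_eq0 mulf_neq0.
    rewrite !size_mul // -subn1 -[X in (_ < X)%N]subn1 ltn_sub2r //.
      by rewrite -[1%N]addn0 -addn1 (leq_trans _ (leq_add (_ : 1 <= size P1)%N (_ : 1 <= size Q)%N)) //
        lt0n size_poly_eq0.
    by rewrite ltn_add2r.
  rewrite (leq_ltn_trans (size_polyD _ _)) // gtn_max mono // andbT.
  by rewrite (mulrC K (V' + cm *: K')) (mulrC K K') mono.
have c0 : 0 < 1 + cp + cm by rewrite -addrA ltr_pwDl // addr_ge0.
have hn0 : (1 + cp + cm)%:P - h != 0.
  case: hs => [->|h1]; first by rewrite subr0 polyC_eq0 gt_eqF.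
  apply/eqP => /eqP; rewrite subr_eq0 => /eqP E; move: h1.
  by rewrite -E size_polyC; case: eqP.
have le : (size (K * K')%R <= size (((1 + cp + cm)%:P - h) * (K * K'))%R)%N.
  rewrite [X in (_ <= X)%N]size_mul ?mulf_neq0 // -subn1 addnC -addnBA; last first.
    by rewrite lt0n size_poly_eq0.
  exact: leq_addr.
by rewrite size_polyDl // size_polyN (leq_trans lt).
Qed.
End SplitAt.

(** * Interior data in terms of polynomials *)

Section Data.
Variable R : realType.
Notation C := (R[i]).
Notation rc := (real_complex R).

Lemma poly_eq_points n (x : 'I_n -> R) (p q : {poly R}) :
  injective x -> (forall i, x i != 0) -> (size p <= n.+1)%N -> (size q <= n.+1)%N ->
  p.[0] = q.[0] -> (forall i, p.[x i] = q.[x i]) -> p = q.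
Proof.
move=> inj x0 sp sq e0 e; apply/eqP; rewrite -subr_eq0; apply/eqP.
apply: (@roots_geq_poly_eq0 _ _ (0 :: [seq x i | i <- enum 'I_n])).
- rewrite /= rootE hornerD hornerN e0 subrr eqxx /=.
  by apply/allP => _ /mapP[i _ ->]; rewrite rootE hornerD hornerN e subrr.
- rewrite /= map_inj_uniq // enum_uniq andbT; apply/mapP => -[i _ /esym/eqP].
  by rewrite (negbTE (x0 i)).
rewrite /= size_map size_enum_ord (leq_trans (size_polyD _ _)) //.
by rewrite geq_max sp size_polyN.
Qed.

Lemma recip_prod_horner0 n (kap : 'I_n -> R) (S : {set 'I_n}) : (recip_prod kap S).[0] = 1.
Proof. by rewrite horner_recip_prod big1 // => j _; rewrite mulr0 subr0. Qed.

Lemma horner_recip_prod_eq0 n (lam : 'I_n -> R) i (S : {set 'I_n}) : lam i != 0 -> i \in S ->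
  (recip_prod (fun j => (lam j)^-1) S).[lam i] = 0.
Proof.
by move=> l0 iS; rewrite horner_recip_prod (bigD1 i) //= mulVf // subrr mul0r.
Qed.

Lemma deriv_recip_prod n (lam : 'I_n -> R) i : lam i != 0 ->
  - lam i * (recip_prod (fun j => (lam j)^-1) finset.setT)^`().[lam i] =
  (recip_prod (fun j => (lam j)^-1) [set~ i]).[lam i].
Proof.
move=> l0; rewrite (@recip_prodD1 _ _ _ _ i) ?inE // finset.setTD; set P := recip_prod _ _.
have -> : ((1 - (lam i)^-1 *: 'X) * P)^`() =
   - (lam i)^-1 *: P + (1 - (lam i)^-1 *: 'X) * P^`().
  by rewrite derivM derivB derivZ derivX derivC sub0r mulNr -scalerAl mul1r scaleNr.
rewrite !hornerE mulVf // subrr mul0r addr0.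
by field.
Qed.

Section Core.
Variables (p : mpair R) (a : R) (N : nat) (lam : 'I_N -> R) (c : 'I_N -> C).
Let s := atoms p.
Let W := (poly_state s).2.
Let A := (poly_state s).1.
Let nu i := (lam i)^-1.

Lemma at_eigenvalue (x : R) : W.[x] = 0 ->
  A.[x] * W^`().[x] = - (gamma_poly s).[x] /\
  (phi_right a s).[x] = expR a * (A.[x] * (phi_left a s).[x]).
Proof.
move=> Wx; split.
  by have /(congr1 (horner^~ x)) := gamma_polyE s; rewrite -/A -/W !hornerE Wx mulr0 subr0.
have [q /(congr1 (horner^~ x))] := phi_at_eigenvalue_poly a (sorted_atoms p).
by rewrite -/s -/A -/W => ->; rewrite hornerD (hornerM W) Wx mul0r addr0 hornerZ hornerM.
Qed.

Lemma phi_value (x : R) : piecewise_sol x%:C (atoms p) (0, 1) a =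
  (expR (- a / 2%:R) * (phi_right a s).[x])%:C.
Proof. exact: phi_plus_real. Qed.

Lemma exp_half_sq : expR (- a / 2%:R) ^+ 2 = (expR a)^-1.
Proof. by rewrite expr2 -expRD -splitr expRN. Qed.

(** At an eigenvalue gamma^2 = - A W' and phi_+ = A phi_-; eliminating A from
c^2 lambda gamma^2 = phi_+^2 gives the value of phi_+ phi_-. As c is nonzero, the
square root in its definition is nonzero too, so lambda gamma^2 is positive; this
makes the eigenvalue nonzero, a simple root of W, and c a real number with the
sign of phi_+. *)
Lemma interior_data_values (hd : is_interior_data p a lam c) (hc : forall i, c i <> 0) i :
  [/\ lam i != 0, W.[lam i] = 0 & W^`().[lam i] != 0] /\
  [/\ c i = (complex.Re (c i))%:C,
    0 < complex.Re (c i) * (phi_right a s).[lam i] &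
    (phi_right a s * phi_left a s).[lam i] = - lam i * W^`().[lam i] * complex.Re (c i) ^+ 2].
Proof.
have [_ ev /(_ i) [phi [/phi_plus_unique -> ci]]] := hd.
rewrite gamma_sq_phi phi_value -/s in ci.
have Wx : W.[lam i] = 0.
  have : is_eigenvalue p (lam i)%:C by apply/ev; exists i.
  by move/eigenvalue_root; rewrite cevalE => -[].
have [AW KK] := at_eigenvalue Wx.
move: AW KK ci; set gam := (gamma_poly s).[lam i]; set K := (phi_right a s).[lam i].
set e := expR (- a / 2%:R); set x := lam i; set Km := (phi_left a s).[x].
move=> AW KK ci; pose d := Num.sqrt (x * gam).
have ciE : c i = (e * K / d)%:C.
  by rewrite ci -/d -fmorphV -rmorphM.
have e0 : 0 < e by exact: expR_gt0.
have : e * K / d != 0.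
  by apply/eqP => z; apply: (hc i); rewrite ciE z.
rewrite !mulf_eq0 !negb_or invr_eq0 => /andP[/andP[_ K0] d0].
have d1 : 0 < d by rewrite lt_neqAle eq_sym d0 sqrtr_ge0.
have g0 : 0 < x * gam by rewrite -sqrtr_gt0.
have x0 : x != 0 by apply: contraTneq g0 => ->; rewrite mul0r ltxx.
have gam0 : gam != 0 by apply: contraTneq g0 => ->; rewrite mulr0 ltxx.
have W'0 : W^`().[x] != 0.
  by apply: contraNneq gam0 => z; rewrite z mulr0 in AW; rewrite -oppr_eq0 -AW.
have A0 : A.[x] != 0.
  by apply: contraNneq gam0 => z; rewrite z mul0r in AW; rewrite -oppr_eq0 -AW.
have ReE : complex.Re (c i) = e * K / d by rewrite ciE.
split; first by [].
split; first by rewrite ReE.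
  rewrite ReE mulrAC divr_gt0 // -mulrA pmulr_rgt0 //.
  by rewrite -expr2 lt_neqAle sqr_ge0 eq_sym sqrf_eq0 K0.
rewrite ReE hornerM -/K -/Km.
have dd : d ^+ 2 = x * gam by rewrite sqr_sqrtr // ltW.
rewrite expr_div_n exprMn dd exp_half_sq -/x.
have gE : gam = - (A.[x] * W^`().[x]) by rewrite AW opprK.
rewrite gE -/K; have ea0 : expR a != 0 by rewrite gt_eqF // expR_gt0.
rewrite -/K -/x KK; field.
by rewrite x0 ea0 A0 W'0.
Qed.

Hypothesis linj : injective lam.

(** The quotient of W by the product over the eigenvalues has no complex root: it
would be an eigenvalue, and a double root of W. *)
Lemma wronskian_prod :
  (forall z : C, is_eigenvalue p z <-> exists i, z = (lam i)%:C) ->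
  (forall i, [/\ lam i != 0, W.[lam i] = 0 & W^`().[lam i] != 0]) ->
  W = recip_prod nu finset.setT.
Proof.
move=> ev H; pose rs := [seq lam i | i <- enum 'I_N].
have urs : uniq rs by rewrite map_inj_uniq // enum_uniq.
have : \prod_(z <- rs) ('X - z%:P) %| W.
  apply: uniq_roots_dvdp; last by rewrite uniq_rootsE.
  by apply/allP => _ /mapP[i _ ->]; have [_ /rootP] := H i.
case/dvdpP => g Wg.
have g1 : size g = 1.
  have : size (map_poly rc g) == 1.
    apply/negPn/negP => /closed_rootP[z /rootP gz].
    have /ev [i zi] : is_eigenvalue p z.
      by apply/eigenvalue_root; rewrite -/s -/W /ceval Wg rmorphM hornerM gz mul0r.
    have gi : g.[lam i] = 0.
      by move: gz; rewrite zi horner_map => -[].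
    have [_ _ /eqP] := H i; apply; rewrite Wg derivM hornerD !hornerM gi mul0r addr0.
    rewrite [X in _ * X](_ : _ = 0) ?mulr0 //; apply/rootP; rewrite root_prod_XsubC.
    by rewrite map_f // mem_enum.
  by rewrite size_map_poly => /eqP.
apply: (poly_eq_points linj) => [i|||| i].
- by have [] := H i.
- rewrite Wg (leq_trans (size_polyMleq _ _)) // g1 size_prod_XsubC size_map size_enum_ord.
  by [].
- by rewrite (leq_trans (size_recip_prod_leq _ _)) // cardsT card_ord.
- rewrite recip_prod_horner0 /W; have [k0 v0] := phi_poly_horner0 0 s.
  by move: k0; rewrite /phi_poly hornerD v0 addr0.
- by have [l0 -> _] := H i; rewrite horner_recip_prod_eq0 // inE.
Qed.

(** Both sides have degree at most the number of eigenvalues, and they agree at the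
eigenvalues and at 0. *)
Lemma numerator_sum (cr : 'I_N -> R) : W = recip_prod nu finset.setT ->
  \sum_i cr i ^+ 2 = 1 ->
  (forall i, lam i != 0 /\ (phi_right a s * phi_left a s).[lam i] =
     - lam i * W^`().[lam i] * cr i ^+ 2) ->
  phi_right a s * phi_left a s = \sum_i cr i ^+ 2 *: recip_prod nu [set~ i].
Proof.
move=> WE c1 H; apply: (poly_eq_points linj) => [i|||| i].
- by have [] := H i.
- rewrite (leq_trans (size_wronskian a (sorted_atoms p) (valid_atoms p))) //.
  by rewrite -/s -/W WE (leq_trans (size_recip_prod_leq _ _)) // cardsT card_ord.
- rewrite (leq_trans (size_sum _ _ _)) //; apply/bigmax_leqP => i _.
  rewrite (leq_trans (size_scale_leq _ _)) // (leq_trans (size_recip_prod_leq _ _)) //.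
  by rewrite ltnS (leq_trans (max_card _)) // card_ord.
- rewrite hornerM (phi_poly_horner0 _ _).1 (phi_poly_horner0 _ _).1 mulr1 horner_sum -c1.
  by apply: eq_bigr => i _; rewrite hornerZ recip_prod_horner0 mulr1.
have [l0 ->] := H i; rewrite WE deriv_recip_prod // horner_sum (bigD1 i) //= big1 => [|j ji].
  by rewrite hornerZ addr0 mulrC.
by rewrite hornerZ horner_recip_prod_eq0 ?mulr0 // !inE eq_sym.
Qed.

(** The elimination of [interior_data_values] in reverse: it gives
c^2 lambda gamma^2 = phi_+^2, so lambda gamma^2 is positive, and the sign
condition selects the right square root. *)
Lemma interior_data_of_polys (cr : 'I_N -> R) : (forall i j : 'I_N, (i < j)%N -> lam i < lam j) ->
  (forall i, lam i != 0) ->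
  W = recip_prod nu finset.setT ->
  phi_right a s * phi_left a s = \sum_i cr i ^+ 2 *: recip_prod nu [set~ i] ->
  (forall i, 0 < cr i * (phi_right a s).[lam i]) ->
  (forall i, c i = (cr i)%:C) ->
  is_interior_data p a lam c.
Proof.
move=> lmon l0 WE KE sg cE; split=> // [z|i].
  rewrite eigenvalue_root -/s -/W WE /ceval.
  have fac i : (map_poly rc (1 - nu i *: 'X)).[z] = 1 - (nu i)%:C * z.
    by rewrite rmorphB rmorph1 /= map_polyZ map_polyX !hornerE.
  have -> : (map_poly rc (recip_prod nu finset.setT)).[z] =
      \prod_(i in [set: 'I_N]%SET) (1 - (nu i)%:C * z).
    by rewrite /recip_prod rmorph_prod horner_prod; apply: eq_bigr => i _; exact: fac.
  split=> [/eqP|[i ->]]; last first.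
    rewrite (bigD1 i) ?inE //= /nu -rmorphM mulVf //.
    by rewrite rmorph1 subrr mul0r.
  rewrite prodf_seq_eq0 => /hasP[i _ /= /andP[_]]; rewrite subr_eq0 => /eqP E.
  exists i; rewrite -[z]mul1r -[1](rmorph1 rc) -(mulfV (l0 i)) rmorphM -mulrA.
  by rewrite -/(nu i) -E mulr1.
exists (piecewise_sol (lam i)%:C (atoms p) (0, 1)); split; first exact: piecewise_sol_phi_plus.
rewrite gamma_sq_phi phi_value -/s cE.
have Wx : W.[lam i] = 0 by rewrite WE horner_recip_prod_eq0 // inE.
have [AW KK] := at_eigenvalue Wx.
have KK2 : (phi_right a s).[lam i] * (phi_left a s).[lam i] = - lam i * W^`().[lam i] * cr i ^+ 2.
  rewrite -hornerM KE WE deriv_recip_prod // horner_sum (bigD1 i) //= big1 => [|j ji].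
    by rewrite hornerZ addr0 mulrC.
  by rewrite hornerZ horner_recip_prod_eq0 ?mulr0 // !inE eq_sym.
have := sg i; move: AW KK KK2; have := exp_half_sq.
set gam := (gamma_poly s).[lam i]; set K := (phi_right a s).[lam i].
have e0 := expR_gt0 (- a / 2%:R); set e := expR (- a / 2%:R) in e0 *.
set x := lam i; set Km := (phi_left a s).[x]; set r := cr i.
move=> ee AW KK KK2 rK.
have gE : r ^+ 2 * (x * gam) = (e * K) ^+ 2.
  have gE : gam = - (A.[x] * W^`().[x]) by rewrite AW opprK.
  have ea : e ^+ 2 * expR a = 1 by rewrite ee mulVf // gt_eqF // expR_gt0.
  transitivity (A.[x] * (- x * W^`().[x] * r ^+ 2)); first by rewrite gE; ring.
  rewrite -KK2 exprMn [K ^+ 2]expr2 {2}KK.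
  transitivity ((e ^+ 2 * expR a) * (A.[x] * (K * Km))); last by ring.
  by rewrite ea mul1r.
have r0 : r != 0 by apply: contraTneq rK => ->; rewrite mul0r ltxx.
have K0 : K != 0 by apply: contraTneq rK => ->; rewrite mulr0 ltxx.
have r2 : 0 < r ^+ 2 by rewrite lt_neqAle sqr_ge0 eq_sym sqrf_eq0 r0.
have g0 : 0 < x * gam.
  rewrite -(pmulr_rgt0 _ r2) gE lt_neqAle sqr_ge0 eq_sym sqrf_eq0 mulf_neq0 //.
  by rewrite gt_eqF.
set d := Num.sqrt (x * gam).
have d0 : 0 < d by rewrite sqrtr_gt0.
have dd : d ^+ 2 = x * gam by rewrite sqr_sqrtr // ltW.
have rd : r * d = e * K.
  have : (r * d) ^+ 2 == (e * K) ^+ 2 by rewrite exprMn dd gE.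
  rewrite eqf_sqr => /orP[/eqP //|/eqP E].
  have : 0 < (r * K) * (d * e) by rewrite mulr_gt0 // mulr_gt0.
  rewrite (_ : r * K * (d * e) = (r * d) * (e * K)); last by ring.
  by rewrite E mulNr oppr_gt0 -expr2 ltNge sqr_ge0.
by rewrite -rd -fmorphV -rmorphM mulfK // gt_eqF.
Qed.
End Core.
End Data.

(** * A pair is determined by the factorization *)

Section Factor.
Variables (R : realType) (n : nat) (kap : 'I_n -> R).
Hypotheses (kinj : injective kap) (k0 : forall j, kap j != 0).
Implicit Types S T : {set 'I_n}.

Lemma recip_prod_inv_eq0 S j : ((recip_prod kap S).[(kap j)^-1] == 0) = (j \in S).
Proof.
rewrite horner_recip_prod; apply/idP/idP => [|jS]; last first.
  by rewrite (bigD1 j) //= mulfV // subrr mul0r.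
rewrite prodf_seq_eq0 => /hasP[i _ /= /andP[iS]]; rewrite subr_eq0 => /eqP e.
by rewrite -(kinj (_ : kap i = kap j)) // -[RHS]mul1r e mulfVK.
Qed.

Lemma recip_prod_inj S T : recip_prod kap S = recip_prod kap T -> S = T.
Proof. by move=> e; apply/setP => j; rewrite -!recip_prod_inv_eq0 e. Qed.

Lemma recip_prod_setC S : recip_prod kap S * recip_prod kap (~: S) = recip_prod kap finset.setT.
Proof.
rewrite /recip_prod [RHS](bigID (mem S)) /=; congr (_ * _); apply: eq_bigl => j; by rewrite !inE.
Qed.

Lemma poly_eq_inv_points S (p q : {poly R}) :
  (size p <= #|S|.+1)%N -> (size q <= #|S|.+1)%N -> p.[0] = q.[0] ->
  (forall j, j \in S -> p.[(kap j)^-1] = q.[(kap j)^-1]) -> p = q.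
Proof.
move=> sp sq e0 e.
apply: (@poly_eq_points _ _ (fun i : 'I_#|S| => (kap (enum_val i))^-1)) => //.
- by move=> i j /invr_inj /kinj /enum_val_inj.
- by move=> i; rewrite invr_eq0.
- by move=> i; apply/e/enum_valP.
Qed.

(** A polynomial with simple real roots has no other factors than the products over
subsets of its roots. *)
Lemma factor_recip_prod (P Q : {poly R}) : P * Q = recip_prod kap finset.setT -> P.[0] = 1 ->
  exists2 S, P = recip_prod kap S & Q = recip_prod kap (~: S).
Proof.
move=> PQ P1; pose S := [set j | root P (kap j)^-1]%SET.
have := recip_prod_neq0 kap finset.setT; rewrite -PQ mulf_eq0 negb_or => /andP[P0 Q0].
have rt j : root P (kap j)^-1 || root Q (kap j)^-1.
  by rewrite -rootM PQ rootE recip_prod_inv_eq0 inE.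
have bound (p : {poly R}) T : p != 0 -> (forall j, j \in T -> root p (kap j)^-1) ->
    (#|T| < size p)%N.
  move=> p0 h; have := @max_poly_roots _ p [seq (kap j)^-1 | j <- enum T] p0.
  rewrite size_map -cardE; apply.
    by apply/allP => _ /mapP[j jT ->]; apply: h; rewrite -mem_enum.
  by rewrite map_inj_uniq ?enum_uniq // => i j /invr_inj /kinj.
have sP : (#|S| < size P)%N by apply: bound => // j; rewrite inE.
have sQ : (#|~: S| < size Q)%N.
  by apply: bound => // j; rewrite !inE; have := rt j; case: root.
have sPQ : (size P + size Q).-1 = n.+1.
  by rewrite -size_mul // PQ size_recip_prod ?cardsT ?card_ord.
have PS : P = recip_prod kap S.
  apply: (@poly_eq_inv_points S).
  - rewrite leqNgt; apply/negP => h.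
    have : (n.+2 < (size P + size Q))%N.
      have := cardsC S; rewrite card_ord => <-.
      by rewrite -addSn -addSn -addnS leq_add.
    by rewrite -[(size P + size Q)%N]prednK ?sPQ ?ltnn // addn_gt0 (leq_ltn_trans _ sP).
  - exact: size_recip_prod_leq.
  - by rewrite P1 recip_prod_horner0.
  - move=> j jS; have /eqP ->
    : (recip_prod kap S).[(kap j)^-1] == 0 by rewrite recip_prod_inv_eq0.
    by apply/eqP; move: jS; rewrite inE rootE.
exists S => //; apply: (mulfI (recip_prod_neq0 kap S)).
by rewrite -{1}PS PQ recip_prod_setC.
Qed.

(** In the equation of [wronskian_at], evaluation at the roots of phi_+ isolates the
growing part on the right of [a], and evaluation at the roots of phi_- the one on
the left. The jump at [a] is then determined as well. *)
Lemma mpair_determined (p r : mpair R) (a : R) S :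
  (poly_state (atoms p)).2 = (poly_state (atoms r)).2 ->
  phi_right a (atoms p) = recip_prod kap S -> phi_right a (atoms r) = recip_prod kap S ->
  phi_left a (atoms p) = recip_prod kap (~: S) -> phi_left a (atoms r) = recip_prod kap (~: S) ->
  p = r.
Proof.
have [sp sr] := (sorted_atoms p, sorted_atoms r).
have [vp vr] := (valid_atoms p, valid_atoms r).
move=> + Kp Kr Kp' Kr'; rewrite (wronskian_at a sp) (wronskian_at a sr) Kp Kr Kp' Kr'.
have [spV _] := phi_grow_size (path_right_part a sp) (valid_filter _ vp).
have [srV _] := phi_grow_size (path_right_part a sr) (valid_filter _ vr).
have [spV' _] := phi_grow_size (path_left_part a sp) (valid_reflects (valid_filter _ vp)).
have [srV' _] := phi_grow_size (path_left_part a sr) (valid_reflects (valid_filter _ vr)).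
rewrite -/(phi_right a _) Kp size_recip_prod // in spV;
  rewrite -/(phi_right a _) Kr size_recip_prod // in srV.
rewrite -/(phi_left a _) Kp' size_recip_prod // in spV';
  rewrite -/(phi_left a _) Kr' size_recip_prod // in srV'.
have p0 : (grow_right a (atoms p)).[0] = (grow_right a (atoms r)).[0].
  by rewrite (phi_poly_horner0 _ _).2 (phi_poly_horner0 _ _).2.
have m0 : (grow_left a (atoms p)).[0] = (grow_left a (atoms r)).[0].
  by rewrite (phi_poly_horner0 _ _).2 (phi_poly_horner0 _ _).2.
rewrite -/(grow_right a _) in spV; rewrite -/(grow_right a _) in srV.
rewrite -/(grow_left a _) in spV'; rewrite -/(grow_left a _) in srV'.
move=> E.
have EV : grow_right a (atoms p) = grow_right a (atoms r).
  apply: (poly_eq_inv_points spV srV p0) => j jS.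
  move/(congr1 (horner^~ (kap j)^-1)): E; rewrite !(hornerD, hornerN, hornerM).
  have /eqP -> : (recip_prod kap S).[(kap j)^-1] == 0 by rewrite recip_prod_inv_eq0.
  rewrite !(mul0r, mulr0, oppr0, add0r, addr0) => /oppr_inj; apply: mulIf.
  by rewrite recip_prod_inv_eq0 inE jS.
have EV' : grow_left a (atoms p) = grow_left a (atoms r).
  apply: (poly_eq_inv_points spV' srV' m0) => j jS.
  move/(congr1 (horner^~ (kap j)^-1)): E; rewrite !(hornerD, hornerN, hornerM).
  have /eqP -> : (recip_prod kap (~: S)).[(kap j)^-1] == 0 by rewrite recip_prod_inv_eq0.
  rewrite !(mul0r, mulr0, oppr0, add0r, addr0) => /oppr_inj; apply: mulfI.
  by rewrite recip_prod_inv_eq0; rewrite inE in jS.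
have Eh : jump_at a (atoms p) = jump_at a (atoms r).
  move: E; rewrite EV EV' => /addrI /oppr_inj.
  by rewrite -!mulrA => /(mulIf _); apply; rewrite mulf_neq0 // recip_prod_neq0.
have ER : right_part a (atoms p) = right_part a (atoms r).
  apply: (phi_grow_inj (path_right_part a sp) (valid_filter _ vp)
      (path_right_part a sr) (valid_filter _ vr)) => //.
  by rewrite -!/(phi_right a _) Kp Kr.
have EL : left_part a (atoms p) = left_part a (atoms r).
  rewrite -[LHS]reflectsK -[RHS]reflectsK; congr (reflects _).
  apply: (phi_grow_inj (path_left_part a sp) (valid_reflects (valid_filter _ vp))
      (path_left_part a sr) (valid_reflects (valid_filter _ vr))) => //.
  by rewrite -!/(phi_left a _) Kp' Kr'.
have EM : mid_part a (atoms p) = mid_part a (atoms r).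
  have := size_mid_part a sp; have := size_mid_part a sr.
  have := all_mid_part a (atoms p); have := all_mid_part a (atoms r).
  have := valid_filter (fun t => pos t == a) vp; have := valid_filter (fun t => pos t == a) vr.
  move: Eh; rewrite /jump_at /total_jump -!/(mid_part a _).
  case: (mid_part a _) => [|t [|//]]; case: (mid_part a _) => [|t' [|//]] //=;
    rewrite ?big_nil ?big_seq1 ?andbT.
  - by move=> e /size_poly_jump; rewrite -e size_poly0.
  - by move=> e _ /size_poly_jump; rewrite e size_poly0.
  by move=> e _ _ /eqP ta /eqP t'a _ _; congr [:: _]; apply: poly_jump_inj e; rewrite ta t'a.
have : atoms p = atoms r.
  by rewrite (split_parts a sp) (split_parts a sr) EL EM ER.
case: p r {sp sr vp vr Kp Kr Kp' Kr' spV srV spV' srV' p0 m0 E EV EV' Eh ER EL EM} =>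
  [s1 h1] [s2 h2] /= e.
by case: _ / e h2 => h2; rewrite (bool_irrelevance h1 h2).
Qed.
End Factor.

(** * Signs *)

Section Signs.
Variables (R : realType) (N : nat) (lam : 'I_N.+1 -> R) (kap : 'I_N -> R).
Variable tau : 'I_N.+1 -> 'I_N.+1.
Hypothesis l0 : forall i, lam i != 0.
Let nu i := (lam i)^-1.
Hypothesis tinj : injective tau.
Hypothesis tmon : forall i j : 'I_N.+1, (i < j)%N -> nu (tau i) < nu (tau j).
Let lo (j : 'I_N) := tau (widen_ord (leqnSn N) j).
Let hi (j : 'I_N) := tau (lift ord0 j).
Hypothesis gap : forall j : 'I_N, nu (lo j) < kap j < nu (hi j).
Implicit Types S T : {set 'I_N}.

Lemma tau_le (i j : 'I_N.+1) : (i <= j)%N -> nu (tau i) <= nu (tau j).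
Proof.
by rewrite leq_eqVlt => /predU1P[/val_inj -> //|/tmon /ltW].
Qed.

Lemma gap_sep (l j : 'I_N) : l != j -> 0 < (nu (lo j) - kap l) * (nu (hi j) - kap l).
Proof.
have [h1 h2] := andP (gap l); have [h3 h4] := andP (gap j).
case: (ltngtP l j) => [lj|jl|/val_inj ->]; last by rewrite eqxx.
  move=> _; have h : nu (hi l) <= nu (lo j) by apply: tau_le.
  by rewrite mulr_gt0 // subr_gt0; lra.
move=> _; have h : nu (hi j) <= nu (lo l) by apply: tau_le.
by rewrite nmulr_lgt0 subr_lt0; lra.
Qed.

(** Among the factors 1 - kap_l z with l in [S], only the one with l = j changes sign
between the two eigenvalues that bound the j-th gap. *)
Lemma gap_sign S j : 0 < nu (lo j) * nu (hi j) ->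
  ((recip_prod kap S).[lam (lo j)] * (recip_prod kap S).[lam (hi j)] < 0) = (j \in S).
Proof.
move=> pos_uv; rewrite !horner_recip_prod -big_split /=.
set u := lo j; set v := hi j.
have luv : 0 < lam u * lam v by rewrite -invr_gt0 invfM.
have fac l : (1 - kap l * lam u) * (1 - kap l * lam v) =
    (lam u * lam v) * ((nu u - kap l) * (nu v - kap l)).
  by rewrite /nu; field; rewrite !l0.
have pos_prod T : j \notin T ->
    0 < \prod_(l in T) ((1 - kap l * lam u) * (1 - kap l * lam v)).
  move=> jT; apply: prodr_gt0 => l lT; rewrite fac mulr_gt0 //; apply: gap_sep.
  by apply: contraNneq jT => <-.
have [jS|jS] := boolP (j \in S); last by rewrite lt_gtF ?pos_prod.
rewrite (big_setD1 j) //= pmulr_llt0 ?pos_prod ?inE ?eqxx // fac pmulr_rlt0 //.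
by have /andP[h1 h2] := gap j; rewrite pmulr_llt0 ?subr_gt0 ?subr_lt0.
Qed.

Variable cr : 'I_N.+1 -> R.

Definition sign_compatible S := forall i, 0 < cr i * (recip_prod kap S).[lam i].

Lemma signs_determine S T j : sign_compatible S -> sign_compatible T ->
  0 < nu (lo j) * nu (hi j) -> (j \in S) = (j \in T).
Proof.
have key U : sign_compatible U -> 0 < nu (lo j) * nu (hi j) ->
    (j \in U) = (cr (lo j) * cr (hi j) < 0).
  move=> cU h; rewrite -gap_sign //.
  have : 0 < (cr (lo j) * cr (hi j)) * ((recip_prod kap U).[lam (lo j)] * (recip_prod kap U).[lam (hi j)]).
    by rewrite mulrACA mulr_gt0.
  case: (ltgtP (cr (lo j) * cr (hi j)) 0) => [h0|h0|->].
  - by rewrite nmulr_rgt0.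
  - by rewrite pmulr_rgt0 // => /lt_gtF.
  by rewrite mul0r ltxx.
by move=> cS cT h; rewrite !key.
Qed.

(** Moves one root from phi_+ to phi_- or back. *)
Definition toggle S j := if j \in S then S :\ j else j |: S.

Lemma toggle_neq S j : toggle S j <> S.
Proof.
move=> /setP /(_ j); rewrite /toggle; case: ifP => jS; first by rewrite !inE eqxx jS.
by rewrite !inE eqxx jS.
Qed.

Lemma sign_compatible_toggle S j : (forall i, 0 < 1 - kap j * lam i) ->
  sign_compatible S -> sign_compatible (toggle S j).
Proof.
move=> h cS i; have := cS i.
have E : (1 - kap j *: 'X).[lam i] = 1 - kap j * lam i by rewrite !hornerE.
rewrite /toggle; case: ifP => jS.
  by rewrite (recip_prodD1 _ jS) hornerM mulrCA E pmulr_rgt0.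
have jT : j \in j |: S by rewrite !inE eqxx.
by rewrite (recip_prodD1 _ jT) setU1K ?jS // hornerM mulrCA E => pS; rewrite mulr_gt0.
Qed.

Lemma tau_onto i : exists k, i = tau k.
Proof. by exists (invF tinj i); rewrite f_invF. Qed.

(** A [kap j] between the negative and the positive reciprocals of the eigenvalues is
smaller in absolute value than all reciprocals of its sign. *)
Lemma straddling_gap j : nu (lo j) < 0 < nu (hi j) ->
  (forall i, 0 < 1 - kap j * lam i) /\
  (forall l, l != j -> 0 < nu (lo l) * nu (hi l)).
Proof.
move=> /andP[lo0 hi0]; have /andP[g1 g2] := gap j; split=> [i|l].
  have [k ik] := tau_onto i.
  have E : 1 - kap j * lam i = (nu i - kap j) * lam i by rewrite mulrBl mulVf.
  rewrite E; have [kj|jk] := leqP k j.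
    have h : nu i <= nu (lo j) by rewrite ik; apply: tau_le.
    rewrite nmulr_lgt0; first by rewrite subr_lt0; lra.
    by rewrite -invr_lt0 -/(nu i); lra.
  have h : nu (hi j) <= nu i by rewrite ik; apply: tau_le.
  rewrite pmulr_rgt0; first by rewrite -invr_gt0 -/(nu i); lra.
  by rewrite subr_gt0; lra.
case: (ltngtP l j) => [lj|jl|/val_inj ->]; last by rewrite eqxx.
  move=> _; have h : nu (hi l) <= nu (lo j) by apply: tau_le.
  have /andP[h1 h2] := gap l.
  by rewrite nmulr_rgt0; lra.
move=> _; have h : nu (hi j) <= nu (lo l) by apply: tau_le.
have /andP[h1 h2] := gap l.
by rewrite mulr_gt0; lra.
Qed.

Lemma exists_straddling_gap i i' : lam i < 0 -> 0 < lam i' ->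
  exists j, nu (lo j) < 0 < nu (hi j).
Proof.
move=> li li'; have [k ik] := tau_onto i; have [k' ik'] := tau_onto i'.
have nk : nu (tau k) < 0 by rewrite -ik invr_lt0.
have nk' : 0 < nu (tau k') by rewrite -ik' invr_gt0.
have [m nm max] := @arg_maxnP _ k (fun k => nu (tau k) < 0) (fun k => k : nat) nk.
have mN : (m < N)%N.
  have : (m < k')%N.
    by rewrite ltnNge; apply/negP => /tau_le; lra.
  by move=> h; apply: leq_trans h _; rewrite -ltnS.
exists (Ordinal mN).
have -> : lo (Ordinal mN) = tau m by rewrite /lo; congr tau; exact/val_inj.
rewrite nm /= lt_neqAle eq_sym invr_eq0 l0 /= leNgt; apply/negP => /max.
by rewrite /= /bump /= add1n ltnn.
Qed.
End Signs.

(** * Construction of a pair from a factorization *)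

Section Construct.
Variable R : realType.

(** The partial fractions of a product over disjoint sets of roots are those of the two
factors. *)
Lemma residue_poly_split n (kap r : 'I_n -> R) (S : {set 'I_n}) :
  residue_poly kap r finset.setT = residue_poly kap r S * recip_prod kap (~: S) +
    recip_prod kap S * residue_poly kap r (~: S).
Proof.
have half (T U : {set 'I_n}) : T = ~: U ->
    \sum_(j in T) (r j * kap j) *: recip_prod kap (finset.setT :\ j) =
    (\sum_(j in T) (r j * kap j) *: recip_prod kap (T :\ j)) * recip_prod kap U.
  move=> TU; rewrite mulr_suml; apply: eq_bigr => j jT; rewrite -scalerAl; congr (_ *: _).
  rewrite /recip_prod [LHS](bigID (mem T)) /=; congr (_ * _); apply: eq_bigl => i.
    by rewrite !inE andbT.
  move: jT; rewrite TU !inE negbK andbT andbC; case: (i =P j) => [-> /negbTE ->|] //=.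
  by rewrite andbT.
rewrite /residue_poly (bigID (mem S)) /= mulrDr; congr (_ + _).
  rewrite (eq_bigl (mem S)) => [|j]; last by rewrite !inE.
  by rewrite (half S (~: S)) ?finset.setCK // mulrA.
rewrite (eq_bigl (mem (~: S))) => [|j]; last by rewrite !inE.
by rewrite (half (~: S) S) // [RHS]mulrC mulrA.
Qed.

Lemma string_of_residues_set n (kap r : 'I_n -> R) (S : {set 'I_n}) (a : R) :
  injective kap -> (forall j, kap j != 0) -> (forall j, 0 < r j) ->
  exists s, [/\ path <%R a (map (@pos R) s), all (@valid_weights R) s,
    phi_poly a s = recip_prod kap S & grow_poly a s = residue_poly kap r S].
Proof.
move=> kinj k0 r0.
have [|||s [ps vs sK sV]] := @string_of_residues R #|S| (fun l => kap (enum_val l))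
  (fun l => r (enum_val l)) a.
- by move=> i j /kinj /enum_val_inj.
- by move=> i.
- by move=> i.
by exists s; rewrite -recip_prod_enum -residue_poly_enum.
Qed.

Lemma coef_recip_prod n (kap : 'I_n -> R) (S : {set 'I_n}) :
  (forall j, j \in S -> kap j != 0) -> (recip_prod kap S)`_#|S| = \prod_(j in S) (- kap j).
Proof.
move=> k0; have := size_recip_prod k0; have ->
  : (recip_prod kap S)`_#|S| = lead_coef (recip_prod kap S).
  by rewrite lead_coefE size_recip_prod.
move=> _; rewrite /recip_prod lead_coef_prod; apply: eq_bigr => j jS.
rewrite lead_coefE size_linear_factor_eq ?k0 //= coefB coefZ coefX coef1 /=.
by rewrite mulr1 sub0r.
Qed.

(** The partial fraction expansion of W / K is 1 minus a multiple [om] of z minus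
fractions with positive residues [r]. The fractions in [S] are realized to the
right of [a] and the others to the left; [om] is the weight of an atom at [a]. It
is nonzero, because W has larger degree than K. *)
Lemma pair_of_splitting (a : R) N (lam cr : 'I_N.+1 -> R) (kap rho : 'I_N -> R) (b : R)
    (S : {set 'I_N}) :
  (forall i j : 'I_N.+1, (i < j)%N -> lam i < lam j) -> (forall i, lam i != 0) ->
  injective kap -> (forall j, kap j != 0) -> (forall j, 0 < rho j) ->
  recip_prod kap finset.setT = \sum_i cr i ^+ 2 *: recip_prod (fun i => (lam i)^-1) [set~ i] ->
  recip_prod (fun i => (lam i)^-1) finset.setT = (1 - b *: 'X) * recip_prod kap finset.setT
    - 'X ^+ 2 * \sum_j rho j *: recip_prod kap [set~ j] ->
  sign_compatible lam kap cr S ->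
  exists2 p : mpair R, is_interior_data p a lam (fun i => (cr i)%:C) &
    phi_right a (atoms p) = recip_prod kap S.
Proof.
move=> lmon l0 kinj k0 rho0 E F sg.
pose r j := rho j / kap j ^+ 2.
have r0 j : 0 < r j by rewrite divr_gt0 // exprn_even_gt0 //= k0.
have [Q [pQ vQ QK QV]] := string_of_residues_set S a kinj k0 r0.
have [L' [pL' vL' LK LV]] := string_of_residues_set (~: S) (- a) kinj k0 r0.
pose L := reflects L'.
pose om := b - \sum_j rho j / kap j.
pose t : R * R * R := (a, om, 0).
have T1 : [set j | kap j != 0]%SET = finset.setT by apply/setP => j; rewrite !inE k0.
have WE : recip_prod (fun i => (lam i)^-1) finset.setT =
    (1 - om *: 'X) * recip_prod kap finset.setT - residue_poly kap r finset.setT.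
  rewrite F (resolve_double_poles kap rho) T1 finset.setCT big_set0 scale0r sub0r.
  rewrite (eq_bigl xpredT) => [|j]; last by rewrite inE.
  by rewrite -/r /om scalerBl; move: (residue_poly _ _ _) (recip_prod _ _) => V K; ring.
have om0 : om != 0.
  apply/eqP => om0; have := congr1 (fun p : {poly R} => size p) WE.
  rewrite om0 scale0r subr0 mul1r size_recip_prod => [|i _]; last by rewrite invr_eq0.
  rewrite cardsT card_ord => e; have : (N.+2 <= N.+1)%N; last by rewrite ltnn.
  rewrite e (leq_trans (size_polyD _ _)) // geq_max size_polyN.
  rewrite (leq_trans (size_recip_prod_leq _ _)) ?cardsT ?card_ord //=.
  by rewrite (leq_trans (size_residue_poly_leq _ _ _)) // cardsT card_ord.
have Lall : all (fun t => pos t < a) L.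
  apply/allP => x xL; have /mapP[y yL' ->] : x \in map (@reflect1 R) L'.
    by rewrite -mem_rev.
  rewrite /reflect1 /pos /= ltrNl.
  by move: pL'; rewrite (path_sortedE lt_trans) => /andP[/allP h _]; apply/h/map_f.
have Qall : all (fun t => a < pos t) Q.
  by move: pQ; rewrite (path_sortedE lt_trans) => /andP[h _]; rewrite all_map in h.
have Lsorted : sorted <%R (map (@pos R) L).
  rewrite map_pos_reflects rev_sorted sorted_map.
  apply: sub_sorted (path_sorted pL') => x y /=; by rewrite ltrN2.
pose s := L ++ t :: Q.
have ss : sorted <%R (map (@pos R) s).
  rewrite /s map_cat (sorted_pairwise lt_trans) pairwise_cat -!(sorted_pairwise lt_trans).
  rewrite Lsorted [sorted _ (map _ (t :: Q))]pQ !andbT allrel_mapl allrel_mapr.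
  apply/allrelP => x y xL; rewrite inE => /predU1P[->|yQ]; first exact: (allP Lall).
  exact: lt_trans (allP Lall _ xL) (allP Qall _ yQ).
have vt : valid_weights t by rewrite /valid_weights /wv /womega /= lexx addr0 normr_gt0.
have vs : all (@valid_weights R) s by rewrite all_cat valid_reflects //= vt.
have ok : [&& (0 < size s)%N, sorted <%R (map (@pos R) s), all (fun t => 0 <= wv t) s &
    all (fun t => 0 < `|womega t| + wv t) s].
  rewrite ss /s size_cat addnS /=; apply/andP; split; apply: sub_all vs => x /andP[] //.
pose p := MPair ok.
have sp : atoms p = s by [].
have nil_left (u : seq (R * R * R)) : all (fun t => a < pos t) u ->
    left_part a u = [::] /\ mid_part a u = [::].
  move=> h; split; apply/eqP; rewrite -(negbK (_ == _)) -has_filter; apply/hasPn =>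
    x /(allP h) ax.
    by rewrite -leNgt ltW.
  by rewrite gt_eqF.
have [Q1 Q2] := nil_left Q Qall.
have lpE : left_part a s = L.
  rewrite /left_part filter_cat /= ltxx -/(left_part a Q) Q1 cats0; exact/all_filterP.
have mpE : mid_part a s = [:: t].
  rewrite /mid_part filter_cat /= eqxx -/(mid_part a Q) Q2.
  have -> : [seq x <- L | pos x == a] = [::]; last by [].
  apply/eqP; rewrite -(negbK (_ == _)) -has_filter; apply/hasPn => x /(allP Lall) xa.
  by rewrite lt_eqF.
have rpE : right_part a s = Q.
  rewrite /right_part filter_cat /= ltxx.
  have -> : [seq x <- L | a < pos x] = [::]; last exact/all_filterP.
  apply/eqP; rewrite -(negbK (_ == _)) -has_filter; apply/hasPn => x /(allP Lall) xa.
  by rewrite -leNgt ltW.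
have KpE : phi_right a (atoms p) = recip_prod kap S by rewrite sp /phi_right rpE.
have KmE : phi_left a (atoms p) = recip_prod kap (~: S) by rewrite sp /phi_left lpE reflectsK.
have W1 : (poly_state (atoms p)).2 = recip_prod (fun i => (lam i)^-1) finset.setT.
  rewrite (wronskian_at a (sorted_atoms p)) KpE KmE /grow_right /grow_left /jump_at sp rpE lpE mpE.
  rewrite reflectsK QV LV WE (residue_poly_split kap r S) -(recip_prod_setC kap S) /total_jump big_seq1.
  have -> : poly_jump t = om *: 'X.
    by rewrite /poly_jump /jump /t /womega /wv /= mulr0 addr0 mulrC mul_polyC.
  move: (recip_prod kap S) (recip_prod kap (~: S)) (residue_poly kap r S) (residue_poly kap r (~: S)) => K K' V V'; ring.
exists p => //.
apply: (interior_data_of_polys (cr := cr)) => //.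
- by rewrite KpE KmE recip_prod_setC.
- by move=> i; rewrite KpE.
Qed.
End Construct.

(** * The two cases *)

Section Final.
Variable R : realType.

Lemma interior_data_polys (p : mpair R) (a : R) N (lam : 'I_N -> R) (c : 'I_N -> R[i]) :
  is_interior_data p a lam c -> (forall i, c i <> 0) -> alpha c = 0 ->
  let cr i := complex.Re (c i) in let nu i := (lam i)^-1 in
  [/\ injective lam, forall i, lam i != 0, forall i, c i = (cr i)%:C &
    \sum_i cr i ^+ 2 = 1] /\
  [/\ (poly_state (atoms p)).2 = recip_prod nu finset.setT,
    phi_right a (atoms p) * phi_left a (atoms p) = \sum_i cr i ^+ 2 *: recip_prod nu [set~ i] &
    forall i, 0 < cr i * (phi_right a (atoms p)).[lam i]].
Proof.
move=> hd hc al cr nu; have [lmon ev _] := hd.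
have linj : injective lam.
  by move=> i j e; apply/val_inj; case: (ltngtP i j) => // /lmon; rewrite e ltxx.
have core := interior_data_values hd hc.
have cE i : c i = (cr i)%:C by have [_ []] := core i.
have c1 : \sum_i cr i ^+ 2 = 1.
  move: al => /eqP; rewrite /alpha subr_eq0 eq_sym => /eqP <-.
  apply: eq_bigr => i _; rewrite cE /= expr0n addr0 sqrtr_sqr.
  by rewrite real_normK ?num_real.
have WE : (poly_state (atoms p)).2 = recip_prod nu finset.setT.
  by apply: wronskian_prod => // i; have [] := core i.
split; split=> //; try by move=> i; have [[] ? ? ? []] := core i.
by apply: numerator_sum => // i; have [[] ? ? ? []] := core i.
Qed.

(** The coefficient of highest degree on the left-hand side is a nonzero multiple of
beta, whereas a vanishing [kap j] would lower the degree on the right. *)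
Lemma recip_roots_neq0 N (lam cr : 'I_N.+1 -> R) (kap : 'I_N -> R) :
  (forall i, lam i != 0) -> \sum_i lam i * cr i ^+ 2 != 0 ->
  \sum_i cr i ^+ 2 *: recip_prod (fun i => (lam i)^-1) [set~ i] = recip_prod kap finset.setT ->
  forall j, kap j != 0.
Proof.
move=> l0 b0 E j; apply/negP => /eqP kj.
have nu0 i : (lam i)^-1 != 0 by rewrite invr_eq0.
have top : (\sum_i cr i ^+ 2 *: recip_prod (fun i => (lam i)^-1) [set~ i])`_N =
    - \prod_i (- (lam i)^-1) * \sum_i lam i * cr i ^+ 2.
  rewrite coef_sum mulr_sumr; apply: eq_bigr => i _; rewrite coefZ.
  have card : #|[set~ i]| = N by rewrite cardsC1 card_ord.
  rewrite -[X in _`_X]card coef_recip_prod //.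
  rewrite (eq_bigl (fun k => k != i)) => [|k]; last by rewrite !inE.
  rewrite [in RHS](bigD1 i) //=.
  by move: (\prod_(_ < _ | _) _) => P; field.
have : \prod_i (- (lam i)^-1) != 0 by apply/prodf_neq0 => i _; rewrite oppr_eq0.
move: top; rewrite E nth_default => [/esym/eqP|].
  by rewrite mulf_eq0 oppr_eq0 (negbTE b0) orbF => ->.
rewrite (@recip_prod_support _ _ _ (finset.setT :\ j)) ?subsetT //.
  rewrite (leq_trans (size_recip_prod_leq _ _)) //.
  by have := cardsD1 j (finset.setT : {set 'I_N});
    rewrite finset.in_setT cardsT card_ord add1n => <-.
by move=> i _; rewrite !inE andbT negbK => /eqP ->.
Qed.
End Final.

Theorem theorem3p5 (R : realType) (a : R) (N : nat)
    (lambda : 'I_N.+1 -> R) (c : 'I_N.+1 -> R[i])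
    (hdata : exists p : mpair R, is_interior_data p a lambda c)
    (halpha : alpha c = 0)
    (hbeta : beta lambda c <> 0)
    (hc : forall i, c i <> 0) :
  ((0 < lambda ord0 \/ lambda ord_max < 0) ->
     exists! p : mpair R, is_interior_data p a lambda c)
  /\
  ((exists j0 : 'I_N, lambda (widen_ord (leqnSn N) j0) < 0 /\
                      0 < lambda (lift ord0 j0)) ->
     exists p q : mpair R, p <> q /\
       forall r : mpair R,
         is_interior_data r a lambda c <-> r = p \/ r = q).
Proof.
have [p hp] := hdata.
have [[linj l0 cE c1] [Wp Kp sp]] := interior_data_polys hp hc halpha.
have [lmon _ _] := hp.
pose cr i := complex.Re (c i); pose nu i := (lambda i)^-1.
have cr0 i : cr i != 0 by apply/eqP => z; apply: (hc i); rewrite cE -/(cr i) z.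
have nuinj : injective nu by move=> i j /invr_inj /linj.
have crpos i : 0 < cr i ^+ 2 by rewrite exprn_even_gt0 //= cr0.
have [tau [kap [rho [b [tinj tmon gap E [kinj rho0 F]]]]]] := interlace_recip nuinj crpos.
rewrite c1 scale1r in E.
have k0 : forall j, kap j != 0.
  apply: (recip_roots_neq0 l0 _ E); apply/eqP => z; apply: hbeta; rewrite /beta.
  apply/eqP; rewrite oppr_eq0; apply/eqP; rewrite -[RHS]z; apply: eq_bigr => i _; congr (_ * _).
  by rewrite cE /= expr0n addr0 sqrtr_sqr real_normK ?num_real.
have desc r : is_interior_data r a lambda c -> exists S,
    [/\ sign_compatible lambda kap cr S, (poly_state (atoms r)).2 = recip_prod nu finset.setT,
      phi_right a (atoms r) = recip_prod kap S & phi_left a (atoms r) = recip_prod kap (~: S)].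
  move=> hr; have [_ [Wr Kr sr]] := interior_data_polys hr hc halpha.
  rewrite E in Kr; have [|S KS KS'] := factor_recip_prod kinj k0 Kr.
    by rewrite (phi_poly_horner0 _ _).1.
  by exists S; split=> // i; rewrite -KS; exact: sr.
have same r r' S : is_interior_data r a lambda c -> is_interior_data r' a lambda c ->
    phi_right a (atoms r) = recip_prod kap S -> phi_right a (atoms r') = recip_prod kap S ->
      r = r'.
  move=> /desc [T [_ Wr rT rT']] /desc [T' [_ Wr' rU rU']] e e'.
  have ET : T = S by apply: (recip_prod_inj kinj k0); rewrite -rT.
  have ET' : T' = S by apply: (recip_prod_inj kinj k0); rewrite -rU.
  rewrite ET in rT rT'; rewrite ET' in rU rU'.
  by apply: (mpair_determined kinj k0 (a := a) (S := S)) => //; rewrite Wr Wr'.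
have [S [cS _ pS _]] := desc p hp.
split=> [onesided|[j0 [neg pos]]].
  exists p; split=> // r hr; have [T [cT _ rT _]] := desc r hr.
  apply: (same p r S) => //; rewrite rT; congr recip_prod; apply/setP => j.
  apply: (signs_determine l0 tmon gap cT cS).
  have lle (i k : 'I_N.+1) : (i <= k)%N -> lambda i <= lambda k.
    by rewrite leq_eqVlt => /predU1P[/val_inj -> //|/lmon/ltW].
  case: onesided => h.
    by rewrite mulr_gt0 // invr_gt0 (lt_le_trans h) // lle.
  rewrite nmulr_rgt0 invr_lt0; apply: le_lt_trans h; apply: lle; exact: leq_ord.
have [j strad] := exists_straddling_gap l0 tinj tmon neg pos.
have [tog others] := straddling_gap l0 tinj tmon gap strad.
have cT := sign_compatible_toggle tog cS.
have [q hq qT] := pair_of_splitting a lmon l0 kinj k0 rho0 (esym E) F cT.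
have {}hq : is_interior_data q a lambda c.
  by rewrite (_ : c = fun i => (cr i)%:C) //; apply/funext => i; rewrite cE.
exists p, q; split=> [pq|r].
  by apply: (@toggle_neq _ S j); apply: (recip_prod_inj kinj k0); rewrite -qT -pq.
split=> [hr|[->|->]] //.
(* the root sets of r and p can differ at the gap j only *)
have [T [cT' _ rT _]] := desc r hr.
have agree l : l != j -> (l \in T) = (l \in S).
  by move=> /others; apply: (signs_determine l0 tmon gap cT' cS).
have [TS|TS] := boolP ((j \in T) == (j \in S)).
  left; apply: (same r p S) => //; rewrite rT; congr recip_prod; apply/setP => l.
  by have [->|/agree //] := eqVneq l j; exact/eqP.
right; apply: (same r q (toggle S j)) => //; rewrite rT; congr recip_prod; apply/setP => l.
have [->|lj] := eqVneq l j.
  by move: TS; rewrite /toggle; case: (j \in S); rewrite !inE eqxx; case: (j \in T).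
by rewrite agree // /toggle; case: ifP; rewrite !inE ?(negbTE lj).
Qed.
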